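(* Let $V$ be an observed nonlinear quantum propagator of $\widehat{(YM)}[i]$ with $\partial V=N_0\sqcup P\sqcup N_1$. Then $H[i|t]_0$ is constant (i.e. $H[i|t_0]_0=H[i|t_1]_0$) if and only if $\mathfrak{H}[V]=0$. One can also write $$H[i|t_0]_0=H[i|t_1]_0\quad \mathrm{mod}\ \ \mathfrak{H}[V]\in A .$$
   Context: $A=A_0\oplus A_1$ is a quantum superalgebra: a $\mathbb{Z}_2$-graded associative unital Fréchet algebra over $\mathbb{K}=\mathbb{R}$ or $\mathbb{C}$ with continuous ring homomorphisms $\epsilon:\mathbb{K}\to A_0$, $c:A\to\mathbb{K}$, $c\circ\epsilon=\mathrm{id}$; $Z$ is its center. $M$ is a quantum supermanifold over $A$, $\mathfrak{g}$ the Lie superalgebra of the gauge quantum Lie supergroup, $i:N\to M$ an embedding of a $4$-dimensional manifold $N$ with coordinates $x^\alpha$, $\alpha=1,\dots,4$ ($x^4$ time), and $E[i]=i^*Hom_Z(TM;\mathfrak{g})\to N$ has fibered quantum coordinates $(x^\alpha,y^\beta)$, with first-derivative coordinates $y^\beta_\alpha$. $L:J\hat D(E[i])\to A$ is the quantum Lagrangian, not explicitly dependent on $x^\alpha$; $(\partial y_\beta.L)$, $(\partial y^\mu_\beta.L)$ are its derivatives with respect to $y^\beta$ and $y^\beta_\mu$. $\widehat{(YM)}[i]\subset J\hat D^2(E[i])$ is the Euler-Lagrange equation $(\partial y_\beta.L)-\partial x_\mu.(\partial y^\mu_\beta.L)=0$. Repeated indices are summed. An observed nonlinear quantum propagator is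 a $4$-dimensional, possibly singular, integral solution $V\subset\widehat{(YM)}[i]$ with $\partial V=N_0\sqcup P\sqcup N_1$, where $N_0,N_1$ are $3$-dimensional space-like admissible Cauchy data (times $t_0,t_1$) and $P$ is a time-like $3$-dimensional integral manifold with $\partial P=\partial N_0\sqcup\partial N_1$. $\sigma_t\subset V$ is the space-like section at time $t$. Define $$\omega_H=(-1)^{\mu+1}[(\partial y^\mu_\beta.L)y^\beta_4-\delta^\mu_4L]\otimes dx^1\wedge\cdots\wedge\widetilde{dx^\mu}\wedge\cdots\wedge dx^4$$ (tilde = omitted), which satisfies $d\omega_H|_V=0$. Orientation conventions: $\int_{\partial V}\omega_H=\int_{N_0}\omega_H-\int_{N_1}\omega_H+\int_P\omega_H$, and on $\sigma_t$ orientations are such that $\int_{\sigma_t}\omega_H=\int_{\sigma_t}[(\partial y^4_\beta.L)y^\beta_4-L]\otimes dx^1\wedge dx^2\wedge dx^3$. Observed quantum Hamiltonian: $H=(\partial y^\alpha_\beta.L)y^\beta_\alpha-L$; observed quantum energy: $H[i|t]_0=\int_{\sigma_t}H\otimes dx^1\wedge dx^2\wedge dx^3\in A$; $H[i|t]_{00}=\int_{\sigma_t}[(\partial y^j_\beta.L)y^\beta_j]\otimes dx^1\wedge dx^2\wedge dx^3\in A$ (sum over spatial $j=1,2,3$). Defect phenomenological quantum energy: $\mathfrak{H}[V]_\partial=\int_P\omega_H$. Defect observed quantum energy: $$\mathfrak{H}[V]=H[i|t_0]_{00}-H[i|t_1]_{00}-\mathfrak{H}[V]_\partial .$$ The ''mod''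 formula means that $H[i|t_0]_0$ and $H[i|t_1]_0$ differ by $\mathfrak{H}[V]$: $H[i|t_0]_0-H[i|t_1]_0=\mathfrak{H}[V]$. *)

(* Defs.v *)
From Stdlib Require List.
From HB Require Import structures.
From mathcomp Require Import all_boot all_order all_algebra.
From mathcomp Require Import boolp classical_sets functions filter reals topology.
From mathcomp Require Import normedtype.
From mathcomp Require Import complex.

Set Implicit Arguments.
Unset Strict Implicit.
Unset Printing Implicit Defensive.

Import Order.TTheory GRing.Theory Num.Theory.
Import numFieldNormedType.Exports.
Import ArrowAsProduct.

Local Open Scope classical_set_scope.
Local Open Scope ring_scope.

HB.instance Definition _ (K : numFieldType) (E F : preTopologicalLmodType K) :=
  GRing.Lmodule.on (E * F)%type.
HB.instance Definition _ (K : numFieldType) n (E : preTopologicalLmodType K) :=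
  GRing.Lmodule.on ('I_n -> E).

Variant real_or_complex (R : realType) :
    forall K : numFieldType, (R -> K) -> Prop :=
| RealCase : @real_or_complex R R id
| ComplexCase : @real_or_complex R R[i] (real_complex R).

Record ground_field (R : realType) := GroundField {
  scalar :> numFieldType ;
  of_real : R -> scalar ;
  scalarP : real_or_complex of_real }.

Definition real_ground (R : realType) : ground_field R :=
  GroundField (RealCase R).

(* Total version of the limit, with value 0 when there is none; all the limits
   taken below are in Hausdorff spaces. *)
Definition limit (K : numFieldType) (E : preTopologicalLmodType K)
    (F : set_system E) : E :=
  xget 0 [set l | F --> l].

(* [tvsType] does not relate the uniform structure to the addition; the first
   axiom makes it the translation-invariant one, so that [cauchy] and
   [countable_uniformity] have their usual meaning. *)
HB.mixin Record isFrechetAlgebra (K : numFieldType) A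
    & Tvs K A & GRing.Algebra K A := {
  frechet_add_unif_continuous : unif_continuous (fun x : A * A => x.1 + x.2) ;
  frechet_hausdorff : hausdorff_space A ;
  frechet_metrizable : countable_uniformity A ;
  frechet_complete : forall F : set_system A,
    ProperFilter F -> cauchy F -> exists l : A, F --> l ;
  frechet_mul_continuous : continuous (fun x : A * A => x.1 * x.2) }.

#[short(type="frechetAlgType")]
HB.structure Definition FrechetAlgebra (K : numFieldType) :=
  {A of Tvs K A & GRing.Algebra K A & isFrechetAlgebra K A}.

(* [grade false] is the even part A_0 and [grade true] the odd part A_1. *)
Record quantum_superalgebra (R : realType) (K : ground_field R) := {
  qalg :> frechetAlgType K ;
  grade : bool -> set qalg ;
  grade0 : forall a, grade a 0 ;
  grade_linear : forall a (k : K) x y,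
    grade a x -> grade a y -> grade a (k *: x + y) ;
  grade_closed : forall a, closed (grade a) ;
  grade_mul : forall a b x y, grade a x -> grade b y -> grade (a (+) b) (x * y) ;
  grade_sum : forall x, exists x0 x1,
    [/\ grade false x0, grade true x1 & x = x0 + x1] ;
  grade_direct : forall x, grade false x -> grade true x -> x = 0 ;
  qeps : {rmorphism K -> qalg} ;
  qeps_even : forall k, grade false (qeps k) ;
  qeps_continuous : continuous (qeps : K^o -> qalg) ;
  qc : {rmorphism qalg -> K} ;
  qc_continuous : continuous (qc : qalg -> K^o) ;
  qc_eps : forall k, qc (qeps k) = k }.

Section Modules.
Context {R : realType} {K : ground_field R} (A : quantum_superalgebra K).

Definition center : set A := [set z | forall a, z * a = a * z].

Record zmodule := {
  zmod :> tvsType K ;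
  zmod_hausdorff : hausdorff_space zmod ;
  zact : A -> zmod -> zmod ;
  zactDr : forall z u v, center z -> zact z (u + v) = zact z u + zact z v ;
  zactDl : forall z z' u, center z -> center z' ->
    zact (z + z') u = zact z u + zact z' u ;
  zactM : forall z z' u, center z -> center z' ->
    zact (z * z') u = zact z (zact z' u) ;
  zact_scalar : forall (k : K) u, zact k%:A u = k *: u ;
  zact_continuous : forall z, center z -> continuous (zact z) }.

(* Actions of [Z] are given as functions of all of [A], of which only the values
   on the centre are ever used. *)
Definition mul_act (z a : A) : A := z * a.
Definition pair_act (E : Type) (aE : A -> E -> E) (z : A) (p : E * E) : E * E :=
  (aE z p.1, aE z p.2).
Definition fun_act (I E : Type) (aE : A -> E -> E) (z : A) (f : I -> E) : I -> E :=
  fun i => aE z (f i).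

(* Z-linearity on a subgroup [T]; an odd central element does not preserve
   A_0^m x A_1^n, whence the condition that [z u] be in [T]. *)
Definition zlinear_on (E F : zmodType) (aE : A -> E -> E) (aF : A -> F -> F)
    (T : set E) (f : E -> F) : Prop :=
  forall z u v, center z -> T u -> T v -> T (aE z u) ->
    f (aE z u + v) = aF z (f u) + f v.

Definition quotient (E F : lmodType K) (f : E -> F) (x v : E) (h : K) : F :=
  h^-1 *: (f (x + h *: v) - f x).

Definition qder (E : lmodType K) (F : preTopologicalLmodType K)
    (f : E -> F) (x v : E) : F :=
  limit (quotient f x v h @[h --> (0 : K)^']).

(* Class Q_w^k: weak differentiability with Z-linear derivative.  [T] is the
   space of directions (a subspace of [E]) and [D] a relatively open subset
   of [T]; the derivative (x, v) |-> Df(x)(v), defined on D x T, is required to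
   be jointly continuous and itself of class Q_w^(k-1). *)
Fixpoint Qw (k : nat) (E F : preTopologicalLmodType K)
    (aE : A -> E -> E) (aF : A -> F -> F) (T D : set E) (f : E -> F)
    {struct k} : Prop :=
  {within D, continuous f} /\
  match k with
  | 0 => True
  | k'.+1 => exists df : E -> E -> F,
      [/\ forall x v, D x -> T v -> quotient f x v h @[h --> (0 : K)^'] --> df x v,
          forall x, D x -> zlinear_on aE aF T (df x)
        & @Qw k' (E * E)%type F (pair_act aE) aF (T `*` T) (D `*` T)
            (fun p => df p.1 p.2)]
  end.

End Modules.

Section Manifolds.
Context {R : realType} {K : ground_field R} (A : quantum_superalgebra K).

Definition coordinate_parity (m n : nat) (j : 'I_(m + n)) : bool :=
  if fintype.split j is inr _ then true else false.

Definition superspace m n : set ('I_(m + n) -> A) :=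
  [set v | forall j, grade (@coordinate_parity m n j) (v j)].

Record quantum_supermanifold m n := {
  qman :> topologicalType ;
  qman_hausdorff : hausdorff_space qman ;
  chart : Type ;
  chart_dom : chart -> set qman ;
  chart_map : chart -> qman -> ('I_(m + n) -> A) ;
  chart_inv : chart -> ('I_(m + n) -> A) -> qman ;
  chart_dom_open : forall c, open (chart_dom c) ;
  chart_cover : forall q, exists c, chart_dom c q ;
  chart_image_open : forall c, exists2 O, open O &
    chart_map c @` chart_dom c = O `&` @superspace m n ;
  chart_mapK : forall c, {in chart_dom c, cancel (chart_map c) (chart_inv c)} ;
  chart_map_continuous : forall c, {within chart_dom c, continuous (chart_map c)} ;
  chart_inv_continuous : forall c,
    {within chart_map c @` chart_dom c, continuous (chart_inv c)} ;
  chart_transition : forall c c' k,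
    Qw k (fun_act (@mul_act _ _ A)) (fun_act (@mul_act _ _ A)) (@superspace m n)
      (chart_map c @` (chart_dom c `&` chart_dom c'))
      (chart_map c' \o chart_inv c) }.

Context {m n : nat} (M : quantum_supermanifold m n).

(* A tangent vector at [q] is recorded by its components in all the charts
   around [q]; [tangent_vector c q v] is the one with components [v] in [c]. *)
Definition tangent_vector (c : chart M) (q : M) (v : 'I_(m + n) -> A) :
    chart M -> 'I_(m + n) -> A :=
  fun c' => if `[< chart_dom c' q >]
            then qder (chart_map c' \o chart_inv c) (chart_map c q) v else 0.

Definition tangent (q : M) : set (chart M -> 'I_(m + n) -> A) :=
  [set xi | exists c v,
    [/\ chart_dom c q, superspace v & xi = tangent_vector c q v]].

Record lie_superalgebra := {
  lie :> zmodule A ;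
  lie_grade : bool -> set lie ;
  lie_grade0 : forall a, lie_grade a 0 ;
  lie_grade_linear : forall a (k : K) x y,
    lie_grade a x -> lie_grade a y -> lie_grade a (k *: x + y) ;
  lie_grade_sum : forall x, exists x0 x1,
    [/\ lie_grade false x0, lie_grade true x1 & x = x0 + x1] ;
  lie_grade_direct : forall x, lie_grade false x -> lie_grade true x -> x = 0 ;
  bracket : lie -> lie -> lie ;
  bracket_linearl : forall (k : K) x y z,
    bracket (k *: x + y) z = k *: bracket x z + bracket y z ;
  bracket_linearr : forall (k : K) x y z,
    bracket x (k *: y + z) = k *: bracket x y + bracket x z ;
  bracket_continuous : continuous (fun p : lie * lie => bracket p.1 p.2) ;
  bracket_grade : forall a b x y, lie_grade a x -> lie_grade b y ->
    lie_grade (a (+) b) (bracket x y) ;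
  bracket_antisym : forall a b x y, lie_grade a x -> lie_grade b y ->
    bracket x y = - ((-1) ^+ (a && b) *: bracket y x) ;
  bracket_jacobi : forall a b x y z, lie_grade a x -> lie_grade b y ->
    bracket x (bracket y z) = bracket (bracket x y) z
      + (-1) ^+ (a && b) *: bracket y (bracket x z) }.

End Manifolds.

Section RealVariables.
Context {R : realType} {K : ground_field R}.

Definition real_quotient n (E : lmodType K) (f : 'rV[R]_n -> E) (k : 'I_n)
    (s : 'rV[R]_n) (h : R) : E :=
  (of_real K h)^-1 *: (f (s + h *: delta_mx 0 k) - f s).

Definition pder n (E : preTopologicalLmodType K) (f : 'rV[R]_n -> E) (k : 'I_n)
    (s : 'rV[R]_n) : E :=
  limit (real_quotient f k s h @[h --> (0 : R)^']).

Fixpoint Cr n (E : preTopologicalLmodType K) (r : nat) (U : set 'rV[R]_n)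
    (f : 'rV[R]_n -> E) {struct r} : Prop :=
  {within U, continuous f} /\
  match r with
  | 0 => True
  | r'.+1 => forall k,
      (forall s, U s -> exists l : E, real_quotient f k s h @[h --> (0 : R)^'] --> l)
      /\ Cr r' U (pder f k)
  end.

Definition smooth n (E : preTopologicalLmodType K) (U : set 'rV[R]_n)
    (f : 'rV[R]_n -> E) : Prop := forall r, Cr r U f.

End RealVariables.

Section Bundle.
Context {R : realType} {K : ground_field R} (A : quantum_superalgebra K).
Context {m n : nat} (M : quantum_supermanifold A m n) (g : lie_superalgebra A).

(* An embedding in [M] of a 4-dimensional manifold N, which its coordinates
   (x^1, ..., x^4) identify with an open set of R^4 *)
Record embedding := {
  emb_dom : set 'rV[R]_4 ;
  emb_dom_open : open emb_dom ;
  emb : 'rV[R]_4 -> M ;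
  emb_inj : {in emb_dom &, injective emb} ;
  emb_continuous : {within emb_dom, continuous emb} ;
  emb_homeo : forall U, open U -> U `<=` emb_dom ->
    exists2 W, open W & emb @` U = W `&` (emb @` emb_dom) ;
  emb_smooth : forall c : chart M,
    smooth (emb_dom `&` emb @^-1` chart_dom c) (chart_map c \o emb) ;
  emb_immersion : forall (c : chart M) p (a : 'I_4 -> R),
    emb_dom p -> chart_dom c (emb p) ->
    \sum_i of_real K (a i) *: pder (chart_map c \o emb) i p = 0 ->
    forall i, a i = 0 }.

Variable i : embedding.

(* The fibre at [p] of E[i] = i^* Hom_Z(TM; g); two elements which agree on the
   tangent space at i(p) are the same point of E[i]. *)
Definition homZ (p : 'rV[R]_4) : set ((chart M -> 'I_(m + n) -> A) -> g) :=
  [set phi |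
    zlinear_on (fun_act (fun_act (@mul_act _ _ A))) (@zact _ _ _ g)
      (tangent (emb i p)) phi
    /\ {within tangent (emb i p), continuous phi}].
Arguments homZ p : clear implicits.

(* Fibred quantum coordinates (x^alpha, y^beta) on E[i]: a trivialization with
   typical fibre [fibre], itself split as the product of the Z-modules [qcoord
   beta] in which the coordinates y^beta take their values. *)
Record fibred_coordinates := {
  fibre :> zmodule A ;
  hom_of : 'rV[R]_4 -> fibre -> (chart M -> 'I_(m + n) -> A) -> g ;
  hom_of_homZ : forall p f, emb_dom i p -> homZ p (hom_of p f) ;
  hom_of_bij : forall p phi, emb_dom i p -> homZ p phi ->
    exists! f, forall xi, tangent (emb i p) xi -> hom_of p f xi = phi xi ;
  hom_of_zlinear : forall p xi, emb_dom i p -> tangent (emb i p) xi ->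
    zlinear_on (@zact _ _ _ fibre) (@zact _ _ _ g) setT
      (fun f => hom_of p f xi) ;
  hom_of_continuous : forall p xi, emb_dom i p -> tangent (emb i p) xi ->
    continuous (fun f => hom_of p f xi) ;
  hom_of_smooth : forall (c : chart M) f v, superspace v ->
    smooth (emb_dom i `&` emb i @^-1` chart_dom c)
      (fun p => hom_of p f (tangent_vector c (emb i p) v)) ;
  index : finType ;
  qcoord : index -> zmodule A ;
  coord : forall b, fibre -> qcoord b ;
  incl : forall b, qcoord b -> fibre ;
  coord_continuous : forall b, continuous (@coord b) ;
  incl_continuous : forall b, continuous (@incl b) ;
  coord_zlinear : forall b,
    zlinear_on (@zact _ _ _ fibre) (@zact _ _ _ (qcoord b)) setT (@coord b) ;
  incl_zlinear : forall b,
    zlinear_on (@zact _ _ _ (qcoord b)) (@zact _ _ _ fibre) setT (@incl b) ;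
  inclK : forall b y, coord b (incl y) = y ;
  incl_other : forall b b' (y : qcoord b'), b != b' -> coord b (incl y) = 0 ;
  sum_incl : forall f, f = \sum_b incl (coord b f) }.

End Bundle.

Section Lagrangian.
Context {R : realType} {K : ground_field R} {A : quantum_superalgebra K}.
Context {m n : nat} {M : quantum_supermanifold A m n} {g : lie_superalgebra A}.
Context {i : embedding M} (E : fibred_coordinates g i).

(* 2-jets of sections of E[i], in the coordinates
   (x^alpha, y^beta, y^beta_alpha, y^beta_(alpha gamma)) *)
Record jet2 := Jet2 {
  jx : 'rV[R]_4 ;
  jy : E ;
  jy1 : 'I_4 -> E ;
  jy2 : 'I_4 -> 'I_4 -> E }.

Definition in_jet2 (j : jet2) : Prop :=
  emb_dom i (jx j) /\ forall a c, jy2 j a c = jy2 j c a.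

Definition jet1_of (j : jet2) : E * ('I_4 -> E) := (jy j, jy1 j).

Definition dir_y (b : index E) (v : qcoord b) : E * ('I_4 -> E) :=
  (incl v, 0).
Definition dir_y1 (mu : 'I_4) (b : index E) (v : qcoord b) : E * ('I_4 -> E) :=
  (0, fun a => if a == mu then incl v else 0).

Definition jet1_fun : Type := 'rV[R]_4 -> E * ('I_4 -> E) -> A.

(* (\partial y_beta . f) and (\partial y^mu_beta . f), as maps qcoord b -> A *)
Definition partial_y (f : jet1_fun) (b : index E) (x : 'rV[R]_4)
    (w : E * ('I_4 -> E)) (v : qcoord b) : A :=
  qder (f x) w (dir_y v).
Definition partial_y1 (f : jet1_fun) (mu : 'I_4) (b : index E) (x : 'rV[R]_4)
    (w : E * ('I_4 -> E)) (v : qcoord b) : A :=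
  qder (f x) w (dir_y1 mu v).

Definition total_der (mu : 'I_4) (f : jet1_fun) (j : jet2) : A :=
  let w := jet1_of j in
  pder (fun x => f x w) mu (jx j)
  + \sum_b partial_y f (jx j) w (coord b (jy1 j mu))
  + \sum_b \sum_a partial_y1 f a (jx j) w (coord b (jy2 j a mu)).

Record lagrangian := {
  lagr :> jet1_fun ;
  lagr_smooth : forall x k, emb_dom i x ->
    Qw k (fun z p => (zact z p.1, fun_act (@zact _ _ _ E) z p.2))
      (@mul_act _ _ A) setT setT (lagr x) ;
  lagr_autonomous : forall x x', emb_dom i x -> emb_dom i x' ->
    lagr x = lagr x' }.

Variable L : lagrangian.

Definition euler_lagrange (j : jet2) : Prop :=
  forall b (v : qcoord b),
    partial_y L (jx j) (jet1_of j) v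
    - \sum_mu total_der mu (fun x w => partial_y1 L mu x w v) j = 0.

Definition YM : set jet2 := [set j | in_jet2 j /\ euler_lagrange j].

(* (\partial y^mu_beta . L) y^beta_alpha, summed over beta *)
Definition momentum (mu a : 'I_4) (j : jet2) : A :=
  \sum_b partial_y1 L mu (jx j) (jet1_of j) (coord b (jy1 j a)).

Definition lagr_at (j : jet2) : A := lagr L (jx j) (jet1_of j).

Definition time : 'I_4 := ord_max.

(* [c] stands for the A-valued 3-form
     \sum_mu c mu (x) dx^1 /\ .. omit dx^mu .. /\ dx^4. *)
Definition form3 : Type := 'I_4 -> jet2 -> A.

Definition volume_form (f : jet2 -> A) : form3 :=
  fun mu j => if mu == time then f j else 0.

(* The indices of 'I_4 start at 0: the sign (-1)^(mu+1) becomes (-1)^mu. *)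
Definition omegaH : form3 := fun mu j =>
  (-1) ^+ mu * (momentum mu time j - (if mu == time then lagr_at j else 0)).

Definition cube d : set 'rV[R]_d := [set s | forall k, 0 <= s 0 k <= 1].

(* Uniform Riemann sums: all the integrands below are continuous on the cube. *)
Definition cube_integral d (f : 'rV[R]_d -> A) : A :=
  limit ((N%:R ^- d *: \sum_(k : {ffun 'I_d -> 'I_N})
           f (\row_l ((k l)%:R / N%:R))) @[N --> \oo]).

Definition singular_cube d : Type := 'rV[R]_d -> jet2.

Definition dx d (u : singular_cube d) (a : 'I_4) (k : 'I_d) (s : 'rV[R]_d) : R :=
  @pder R (real_ground R) d R^o (fun s => jx (u s) 0 a) k s.

Definition pullback3 (w : form3) (u : singular_cube 3) (s : 'rV[R]_3) : A :=
  \sum_(mu < 4) of_real K (\det (\matrix_(a < 3, k < 3) dx u (@lift 4 mu a) k s))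
    *: w mu (u s).

Definition chain d : Type := seq (int * singular_cube d).

Definition chain_integral (w : form3) (c : chain 3) : A :=
  \sum_(ku <- c) cube_integral (pullback3 w ku.2) *~ ku.1.

Definition chain_opp d (c : chain d) : chain d := [seq (- ku.1, ku.2) | ku <- c].

Definition face d (u : singular_cube d.+1) (l : 'I_d.+1) (e : bool) :
    singular_cube d :=
  fun s => u (\row_j (if unlift l j is Some k then s 0 k else e%:R)).

(* \sum_l (-1)^l (face s_l = 1 - face s_l = 0): outward normal first *)
Definition cube_boundary d (u : singular_cube d.+1) : chain d :=
  [seq ((-1) ^+ (le.1 + ~~ le.2), face u le.1 le.2) | le : 'I_d.+1 * bool].

Definition boundary d (c : chain d.+1) : chain d :=
  [seq (ku.1 * kf.1, kf.2) | ku <- c, kf <- cube_boundary ku.2].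

Definition eq_cube d (u u' : singular_cube d) : Prop :=
  forall s, cube s -> u s = u' s.

Definition degenerate d (u : singular_cube d) : Prop :=
  exists k, forall s s', cube s -> cube s' ->
    (forall l, l != k -> s 0 l = s' 0 l) -> u s = u s'.

Definition coefficient d (c : chain d) (u : singular_cube d) : int :=
  \sum_(ku <- c) (if `[< eq_cube ku.2 u >] then ku.1 else 0).

(* Equality in the group of cubical chains modulo degenerate cubes *)
Definition chain_eq d (c c' : chain d) : Prop :=
  forall u, ~ degenerate u -> coefficient c u = coefficient c' u.

Definition smooth_cube d (u : singular_cube d) : Prop :=
  exists U : set 'rV[R]_d, [/\ open U, @cube d `<=` U &
    [/\ forall a, @smooth R (real_ground R) d R^o U (fun s => jx (u s) 0 a),
        smooth U (fun s => jy (u s)),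
        forall a, smooth U (fun s => jy1 (u s) a)
      & forall a c, smooth U (fun s => jy2 (u s) a c)]].

(* Integral cubes of (YM)[i]: they annihilate the contact forms
   dy - y_a dx^a and dy_a - y_(a c) dx^c. *)
Definition integral_cube d (u : singular_cube d) : Prop :=
  [/\ smooth_cube u,
      forall s, cube s -> YM (u s),
      forall s k, cube s ->
        pder (fun s => jy (u s)) k s =
        \sum_a of_real K (dx u a k s) *: jy1 (u s) a
    & forall s k a, cube s ->
        pder (fun s => jy1 (u s) a) k s =
        \sum_c of_real K (dx u c k s) *: jy2 (u s) a c].

Definition integral_chain d (c : chain d) : Prop :=
  List.Forall (fun ku => integral_cube ku.2) c.

Definition space_like (t : R) (c : chain 3) : Prop :=
  List.Forall (fun ku => forall s, cube s -> jx (ku.2 s) 0 time = t) c.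

(* The 1-form dx^4 does not vanish anywhere on the chain. *)
Definition time_like (c : chain 3) : Prop :=
  List.Forall
    (fun ku => forall s, cube s -> exists l, dx ku.2 time l s != 0) c.

(* Possibly singular compact oriented manifolds are represented by smooth
   singular cubical chains, as obtained from a cubical subdivision; the maps to
   the jet space and to the base need not be immersions. *)
Record propagator (t0 t1 : R) := {
  body : chain 4 ;
  cauchy0 : chain 3 ;
  cauchy1 : chain 3 ;
  lateral : chain 3 ;
  body_integral : integral_chain body ;
  cauchy0_integral : integral_chain cauchy0 ;
  cauchy1_integral : integral_chain cauchy1 ;
  lateral_integral : integral_chain lateral ;
  cauchy0_space_like : space_like t0 cauchy0 ;
  cauchy1_space_like : space_like t1 cauchy1 ;
  lateral_time_like : time_like lateral ;
  body_boundary :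
    chain_eq (boundary body) (cauchy0 ++ chain_opp cauchy1 ++ lateral) ;
  lateral_boundary :
    chain_eq (boundary lateral)
      (chain_opp (boundary cauchy0) ++ boundary cauchy1) }.

Definition hamiltonian (j : jet2) : A :=
  \sum_a momentum a a j - lagr_at j.

(* H[i|t]_0 and H[i|t]_00, as functions of the section sigma_t *)
Definition energy0 (sigma : chain 3) : A :=
  chain_integral (volume_form hamiltonian) sigma.
Definition energy00 (sigma : chain 3) : A :=
  chain_integral
    (volume_form (fun j => \sum_(a | a != time) momentum a a j)) sigma.

Variables (t0 t1 : R) (V : propagator t0 t1).

(* The coefficient of dx^1 /\ dx^2 /\ dx^3 in omegaH is minus
   (\partial y^4_beta . L) y^beta_4 - L.  Hence the orientation of sigma_t for
   which the integral of omegaH over the Cauchy datum N is that of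
   ((\partial y^4_beta . L) y^beta_4 - L) dx^1 /\ dx^2 /\ dx^3 over sigma_t is
   opposite to that of N in boundary V = N_0 - N_1 + P. *)
Definition section0 : chain 3 := chain_opp (cauchy0 V).
Definition section1 : chain 3 := chain_opp (cauchy1 V).

Definition phenomenological_defect : A := chain_integral omegaH (lateral V).

Definition defect_energy : A :=
  energy00 section0 - energy00 section1 - phenomenological_defect.

End Lagrangian.

(* Main.v *)
(** On an integral cube of (YM)[i] the 3-form omega_H is closed: its differential
    is the divergence of the current
      T^mu = (\partial y^mu_beta . L) y^beta_4 - delta^mu_4 L,
    which vanishes by the Euler-Lagrange equation, by the symmetry of the second
    derivatives y^beta_(alpha gamma) and because L does not depend on x.  By
    Stokes' theorem on the cubes of V, the integrals of omega_H over N_0, - N_1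
    and P add up to 0.  On a space-like chain dx^4 = 0, so only the component
    mu = 4 of omega_H survives there, and its integral is that of the spatial
    momentum terms minus that of H; substituting this for N_0 and N_1 gives the
    energy balance.

    Integrals are limits of Riemann sums in a Frechet space and L is only weakly
    differentiable, so all the analysis rests on one mean value theorem: a
    difference quotient lies in every convex set of which all the derivatives are
    interior points.  It yields the chain rule, the symmetry of second partial
    derivatives, and Stokes' theorem by telescoping the Riemann sums of opposite
    faces over a grid of the cube. *)
Require Import Defs.
From HB Require Import structures.
From mathcomp Require Import all_boot all_order all_algebra.
From mathcomp Require Import boolp classical_sets functions filter reals topology.
From mathcomp Require Import interval_inference convex normedtype complex.
From mathcomp Require Import ring lra.
Set Implicit Arguments.
Unset Strict Implicit.
Unset Printing Implicit Defensive.
Import Order.TTheory GRing.Theory Num.Theory.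
Import numFieldNormedType.Exports.
Local Open Scope classical_set_scope.
Local Open Scope ring_scope.

(** A cube of V is an arbitrary smooth map, possibly singular, on which x^1, ..., x^4 need not be
    coordinates, so closedness cannot be checked in the variables x and transported. On the cube,
    the coefficients of the pullback of omega_H are sums of minors of the Jacobian matrix J of the
    x^a times components of the current. Upon differentiation the derivatives of the minors cancel
    by the Piola identity, which rests on the symmetry of the second derivatives of the x^a; what
    remains is det J times the divergence, by cofactor expansion and without inverting J.

    A second obstacle is that the equations and the equality of chains hold on the closed cube only,
    while partial derivatives are two-sided. Functions are differentiated on an open set U around
    the cube and the equations are used on the cube; one-sided limits show that pullbacks depend
    only on values on the cube. Since pullbacks to degenerate cubes vanish, integration is defined
    on the group in which the boundary of V is given.

    Limits in A are tested on open convex neighbourhoods: uniform Riemann sums are means, so they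
    stay in any convex set that contains their terms. *)

Section OfReal.
Context {R : realType} (K : ground_field R).

Lemma of_real_zmod_morphism : zmod_morphism (of_real K).
Proof. by case: K => S f []//=; exact: raddfB. Qed.

Lemma of_real_monoid_morphism : monoid_morphism (of_real K).
Proof. by case: K => S f []//=; split; [exact: rmorph1|exact: rmorphM]. Qed.

HB.instance Definition _ :=
  GRing.isZmodMorphism.Build R K (of_real K) of_real_zmod_morphism.
HB.instance Definition _ :=
  GRing.isMonoidMorphism.Build R K (of_real K) of_real_monoid_morphism.

Lemma of_real_ge0 x : (0 <= of_real K x) = (0 <= x).
Proof. by case: K => S f []//=; rewrite (lecR 0). Qed.

Lemma of_real_norm x : `|of_real K x| = of_real K `|x|.
Proof.
case: K => S f []//=; have [x0|/ltW x0] := leP 0 x.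
  by rewrite (ger0_norm x0) ger0_norm// (lecR 0).
by rewrite (ler0_norm x0) ler0_norm ?rmorphN// (lecR _ 0).
Qed.

(** The order of [R[i]] compares only numbers with the same imaginary part, so a positive scalar is
    real and radii in [K] can be taken in [R]. *)
Lemma of_real_gt0_ex e : 0 < e -> exists2 r, 0 < r & of_real K r = e.
Proof.
case: K e => S f []/=; first by move=> e; exists e.
by move=> [a b]; rewrite ltcE/= => /andP[/eqP-> a0]; exists a.
Qed.

Lemma of_real_continuous : continuous (of_real K : R -> K^o).
Proof.
move=> x; apply/cvgrPdist_lt => _ /of_real_gt0_ex[e e0 <-].
near=> y; rewrite -rmorphB of_real_norm -subr_gt0 -rmorphB lt0r of_real_ge0.
rewrite fmorph_eq0 -lt0r subr_gt0; near: y.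
by apply: (cvgrPdist_lt _ _).1 => //; exact: cvg_id.
Unshelve. all: by end_near. Qed.

End OfReal.


(** * Limits and convexity in topological vector spaces *)

Section TvsLimits.
Context {K : numFieldType} {E : topologicalLmodType K}.
Context {T : Type} {F : set_system T} {FF : Filter F}.

Lemma tvs_cvgD (f g : T -> E) a b :
  f @ F --> a -> g @ F --> b -> (fun x => f x + g x) @ F --> a + b.
Proof.
move=> fa gb; apply: (continuous2_cvg (h := +%R) FF _ fa gb).
exact: (add_continuous (a, b)).
Qed.

Lemma tvs_cvgZ (k : T -> K) (f : T -> E) c a :
  (k : T -> K^o) @ F --> (c : K^o) -> f @ F --> a ->
  (fun x => k x *: f x) @ F --> c *: a.
Proof.
move=> kc fa; apply: (continuous2_cvg (V := K^o) (h := *:%R) FF _ kc fa).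
exact: (scale_continuous (c : K^o, a)).
Qed.

Lemma tvs_cvgZr (k : K) (f : T -> E) a :
  f @ F --> a -> (fun x => k *: f x) @ F --> k *: a.
Proof. by move=> fa; apply: tvs_cvgZ fa; exact: cvg_cst. Qed.

Lemma tvs_cvgN (f : T -> E) a : f @ F --> a -> (fun x => - f x) @ F --> - a.
Proof.
move=> fa; rewrite -scaleN1r; under eq_fun do rewrite -scaleN1r.
exact: tvs_cvgZr.
Qed.

Lemma tvs_cvgB (f g : T -> E) a b :
  f @ F --> a -> g @ F --> b -> (fun x => f x - g x) @ F --> a - b.
Proof. by move=> fa gb; apply: tvs_cvgD => //; exact: tvs_cvgN. Qed.

Lemma tvs_cvg_sum (I : Type) (r : seq I) (P : pred I) (f : I -> T -> E) a :
  (forall i, P i -> f i @ F --> a i) ->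
  (fun x => \sum_(i <- r | P i) f i x) @ F --> \sum_(i <- r | P i) a i.
Proof.
move=> fa; elim: r => [|i r IH].
  by rewrite big_nil; under eq_fun do rewrite big_nil; exact: cvg_cst.
rewrite big_cons; under eq_fun do rewrite big_cons.
by case: ifP => // Pi; apply: tvs_cvgD => //; exact: fa.
Qed.

End TvsLimits.

Section Convex.
Context {R : realType} {K : ground_field R}.

(** Weights are real even over complex scalars: they arise as ratios of lengths of real intervals
    and from counting grid points. *)
Definition real_convex (E : lmodType K) (C : set E) := forall x y (t : R),
  0 <= t <= 1 -> C x -> C y -> C (of_real K t *: x + of_real K (1 - t) *: y).

Lemma tvs_convex_nbhs (E : tvsType K) (x : E) (U : set E) : nbhs x U ->
  exists C, [/\ real_convex C, open C, C x & C `<=` U].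
Proof.
have [B convB [openB nbhsB]] := @locally_convex K E.
move=> /nbhsB[C [BC Cx] CU]; exists C; split=> //; last exact: openB.
move=> y z t /andP[t0 t1] Cy Cz.
have k0 : 0 <= of_real K t by rewrite of_real_ge0.
have k1 : of_real K t <= 1.
  by rewrite -subr_ge0 -(rmorph1 (of_real K)) -rmorphB of_real_ge0 subr_ge0.
have := convB C (mem_set BC) y z (Itv01 k0 k1) (mem_set Cy) (mem_set Cz).
by move/set_mem; rewrite rmorphB rmorph1.
Qed.

(** The mean over [i :: r'] combines [f i], with weight 1 / (size r' + 1), and the mean over [r'].
    Uniform Riemann sums are such means. *)
Lemma real_convex_sum (E : lmodType K) (C : set E) (I : finType) (f : I -> E) :
  (0 < #|I|)%N -> real_convex C -> (forall i, C (f i)) ->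
  C (#|I|%:R^-1 *: \sum_i f i).
Proof.
move=> I0 convC Cf; rewrite cardE -big_enum.
have : (0 < size (enum I))%N by rewrite -cardE.
elim: (enum I) => // i [|j r] IH _; first by rewrite big_seq1 invr1 scale1r.
rewrite big_cons; set r' := j :: r in IH *.
have t01 : 0 <= ((size r').+1%:R : R)^-1 <= 1.
  by rewrite invr_ge0 ler0n invf_le1 ?ltr0n// ler1n.
have := convC _ _ _ t01 (Cf i) (IH isT); rewrite scalerDr scalerA.
congr C; congr (_ *: _ + _ *: _); first by rewrite fmorphV rmorph_nat.
rewrite rmorphB rmorph1 fmorphV rmorph_nat.
by rewrite /= -natr1; field; rewrite ![1 + _]addrC !natr1 !pnatr_eq0.
Qed.

End Convex.

(** * The mean value theorem in a locally convex space *)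

Section MeanValue.
Context {R : realType} {K : ground_field R} {A : tvsType K}.

(** Continuous induction: the supremum of the t with [P a t] can only be b. The point a is put into
    [S] by hand, because [P] is handled on intervals of positive length only. *)
Lemma interval_cover_ind (P : R -> R -> Prop) a b : a < b ->
  (forall c d e, a <= c -> c < d -> d < e -> e <= b -> P c d -> P d e -> P c e) ->
  (forall s, a <= s <= b -> exists2 e, 0 < e &
     forall c d, a <= c <= s -> s <= d <= b -> c < d -> s - e < c -> d < s + e ->
     P c d) ->
  P a b.
Proof.
move=> ab glue loc.
pose S := [set t | a <= t <= b /\ (t = a \/ P a t)].
have Sa : S a by split; [rewrite lexx ltW|left].
have supS : has_sup S by split; [exists a|exists b => t [/andP[]]].
have ubS t : S t -> t <= sup S by exact: (sup_upper_bound supS).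
have as_ : a <= sup S by exact: ubS.
have sb : sup S <= b by apply: ge_sup; [exists a|move=> t [/andP[]]].
have [|e e0 Pe] := loc (sup S); first by rewrite as_ sb.
have [t [/andP[at_ tb] aPt] et] := sup_adherent e0 supS.
have ts : t <= sup S by apply: ubS; split=> //; rewrite at_.
(* If t < d, then [P t d] holds by the local hypothesis at the supremum, so d belongs to [S] and
   cannot exceed the supremum; this forces d = b. *)
pose d := Num.min (sup S + e / 2) b.
have sd : sup S <= d by rewrite /d le_min sb andbT lerDl; lra.
have db : d <= b by rewrite /d ge_min lexx orbT.
have de : d < sup S + e by rewrite /d gt_min; apply/orP; left; lra.
have [td|] := ltP t d; last first.
  move=> dt; have dE : d = t by apply/le_anti; rewrite dt (le_trans ts).
  have dEs : d = sup S by apply/le_anti; rewrite sd dE ts.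
  have dEb : d = b.
    move: dEs; rewrite /d minElt; case: ifP => // _ /eqP.
    by rewrite -subr_eq0 addrC addKr => /eqP; lra.
  by case: aPt => [ta|]; [move: ab; rewrite -dEb dE ta ltxx|rewrite -dE dEb].
have Ptd : P t d by apply: Pe => //; rewrite ?at_ ?sd ?db.
have Pad : P a d.
  case: aPt => [<-//|Pat]; have [<-//|ta] := eqVneq t a.
  by apply: glue Pat Ptd => //; rewrite lt_neqAle eq_sym ta.
suff -> : b = d by [].
have ds : d <= sup S.
  by apply: ubS; split; [rewrite (le_trans at_ (ltW td)) db|right].
by move: ds; rewrite /d minElt; case: ifP => // _; lra.
Qed.

Definition real_derivative (f : R -> A) (r : R) (d : A) :=
  (of_real K h)^-1 *: (f (r + h) - f r) @[h --> (0 : R)^'] --> d.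

(** The quotient over [c, e] is the convex combination of those over [c, d] and [d, e] with weights
    proportional to the lengths, so lying in [C] is additive over intervals. A short interval with
    an endpoint s has its quotient in [C] because [D s] is interior to [C]; a short interval around
    s is cut at s. *)
Lemma mean_value (f D : R -> A) (C : set A) a b : a < b -> real_convex C ->
  (forall r, a <= r <= b -> real_derivative f r (D r)) ->
  (forall r, a <= r <= b -> nbhs (D r) C) ->
  C ((of_real K (b - a))^-1 *: (f b - f a)).
Proof.
move=> ab convC fD DC.
pose P c d := C ((of_real K (d - c))^-1 *: (f d - f c)); rewrite -[C _]/(P a b).
have glue c d e : c < d -> d < e -> P c d -> P d e -> P c e.
  move=> cd de Pcd Pde.
  have t01 : 0 <= (d - c) / (e - c) <= 1.
    rewrite divr_ge0 ?subr_ge0 ?(ltW cd) ?(ltW (lt_trans cd de))//=.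
    by rewrite ler_pdivrMr ?mul1r ?lerD2r ?(ltW de)// subr_gt0 (lt_trans cd).
  have := convC _ _ _ t01 Pcd Pde; rewrite /P !scalerA; congr C.
  have ce := lt_trans cd de.
  have -> : 1 - (d - c) / (e - c) = (e - d) / (e - c).
    by field; rewrite subr_eq0 gt_eqF.
  have simp u : u != 0 ->
      of_real K (u / (e - c)) * (of_real K u)^-1 = (of_real K (e - c))^-1.
    by move=> u0; rewrite fmorph_div/= mulrAC divff ?mul1r// fmorph_eq0.
  rewrite !simp ?subr_eq0 ?gt_eqF// -scalerDr.
  congr (_ *: _); rewrite addrC. by rewrite addrA subrK.
apply: (@interval_cover_ind P) => //; first by move=> c d e _ cd de _; exact: glue cd de.
move=> s sab; have := fD s sab C (DC s sab).
rewrite /dnbhs/= /within/= => -[e /= e0 eP]; exists e => //.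
have q h : h != 0 -> `|h| < e -> C ((of_real K h)^-1 *: (f (s + h) - f s)).
  by move=> h0 he; apply: eP => //; rewrite /ball_/= sub0r normrN.
have Pl c : c < s -> s - e < c -> P c s.
  move=> cs ec; have := q (c - s); rewrite subr_eq0 lt_eqF// ltr0_norm ?subr_lt0//.
  rewrite opprB [s + _]addrC subrK => /(_ isT); rewrite ltrBlDr -ltrBlDl => /(_ ec).
  by rewrite /P -[f s - _]opprB scalerN -scaleNr -invrN -rmorphN opprB.
have Pr d : s < d -> d < s + e -> P s d.
  move=> sd de; have := q (d - s); rewrite subr_eq0 gt_eqF// gtr0_norm ?subr_gt0//.
  by rewrite [s + _]addrC subrK => /(_ isT); rewrite ltrBlDl => /(_ de).
move=> c d /andP[ac cs] /andP[sd db] cd ec de.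
move: cs; rewrite le_eqVlt => /predU1P[cs|cs]; first by rewrite cs in cd *; exact: Pr.
move: sd; rewrite le_eqVlt => /predU1P[sd|sd]; first by rewrite -sd; exact: Pl.
by apply: glue (Pl _ cs ec) (Pr _ sd de).
Qed.

End MeanValue.


(** * Partial derivatives and the chain rule *)

Section Derivatives.
Context {R : realType} {K : ground_field R}.

(** Weak derivatives are limits over increments in [K]; this restricts them to real increments. *)
Lemma of_real_dnbhs : of_real K h @[h --> (0 : R)^'] --> (0 : K)^'.
Proof.
have := @continuous_injective_withinNx R K (of_real K) 0 (@of_real_continuous R K 0).
by rewrite rmorph0; apply => y /eqP; rewrite fmorph_eq0 => /eqP.
Qed.

Lemma of_real_cvg0 : (of_real K h : K^o) @[h --> (0 : R)^'] --> (0 : K^o).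
Proof.
have := @of_real_continuous R K 0; rewrite /continuous_at rmorph0.
exact: cvg_within_filter.
Qed.

Definition has_pder n (E : preTopologicalLmodType K) (f : 'rV[R]_n -> E)
    (k : 'I_n) (s : 'rV[R]_n) (l : E) :=
  real_quotient f k s h @[h --> (0 : R)^'] --> l.

Lemma limit_eq (E : preTopologicalLmodType K) (F : set_system E) l :
  hausdorff_space E -> ProperFilter F -> F --> l -> limit F = l.
Proof.
move=> hE FF Fl; have FlF : F --> limit F.
  exact: (@xgetPex _ 0 [set l | F --> l] (ex_intro _ l Fl)).
exact: (cvg_unique hE FlF Fl).
Qed.

Lemma has_pder_pder n (E : preTopologicalLmodType K) (f : 'rV[R]_n -> E) k s :
  (exists l, has_pder f k s l) -> has_pder f k s (pder f k s).
Proof.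
by move=> fl; exact: (@xgetPex _ 0 [set l | _ --> l] fl).
Qed.

Lemma pder_eq n (E : preTopologicalLmodType K) (f : 'rV[R]_n -> E) k s l :
  hausdorff_space E -> has_pder f k s l -> pder f k s = l.
Proof. by move=> hE; apply: limit_eq. Qed.

Lemma has_pder_cst n (E : preTopologicalLmodType K) (a : E) k (s : 'rV[R]_n) :
  has_pder (cst a) k s 0.
Proof.
rewrite /has_pder/real_quotient; under eq_fun do rewrite subrr scaler0.
exact: cvg_cst.
Qed.

Lemma has_pder_line n (E : topologicalLmodType K) (f : 'rV[R]_n -> E) k s l :
  has_pder f k s l -> f (s + h *: delta_mx 0 k) @[h --> (0 : R)^'] --> f s.
Proof.
move=> fl.
have : of_real K h *: real_quotient f k s h + f s @[h --> (0 : R)^']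
    --> (0 : K) *: l + f s.
  apply: tvs_cvgD; last exact: cvg_cst.
  by apply: tvs_cvgZ fl; exact: of_real_cvg0.
rewrite scale0r add0r; apply: cvg_trans; apply: near_eq_cvg.
near=> h; rewrite /real_quotient scalerA divff ?scale1r ?subrK// fmorph_eq0.
by near: h; exact: nbhs_dnbhs_neq.
Unshelve. all: by end_near. Qed.

Lemma has_pderD n (E : topologicalLmodType K) (f g : 'rV[R]_n -> E) k s a b :
  has_pder f k s a -> has_pder g k s b ->
  has_pder (fun s => f s + g s) k s (a + b).
Proof.
move=> fa gb; rewrite /has_pder /real_quotient.
under eq_fun do rewrite opprD addrACA scalerDr.
exact: tvs_cvgD.
Qed.

Lemma has_pderZr n (E : topologicalLmodType K) (c : K) (f : 'rV[R]_n -> E) k s a :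
  has_pder f k s a -> has_pder (fun s => c *: f s) k s (c *: a).
Proof.
move=> fa; rewrite /has_pder /real_quotient.
under eq_fun do rewrite -scalerBr scalerA mulrC -scalerA.
exact: tvs_cvgZr.
Qed.

Lemma has_pderB n (E : topologicalLmodType K) (f g : 'rV[R]_n -> E) k s a b :
  has_pder f k s a -> has_pder g k s b ->
  has_pder (fun s => f s - g s) k s (a - b).
Proof.
move=> fa gb; apply: has_pderD => //; rewrite -scaleN1r.
by under eq_fun do rewrite -scaleN1r; exact: has_pderZr.
Qed.

Lemma has_pder_sum n (E : topologicalLmodType K) (I : Type) (r : seq I)
    (P : pred I) (f : I -> 'rV[R]_n -> E) k s a :
  (forall i, P i -> has_pder (f i) k s (a i)) ->
  has_pder (fun s => \sum_(i <- r | P i) f i s) k s (\sum_(i <- r | P i) a i).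
Proof.
move=> fa; elim: r => [|i r IH].
  by rewrite big_nil; under eq_fun do rewrite big_nil; exact: has_pder_cst.
rewrite big_cons; under eq_fun do rewrite big_cons.
by case: ifP => // Pi; apply: has_pderD => //; exact: fa.
Qed.

End Derivatives.

Lemma has_pderZ (R : realType) (K : ground_field R) n (E : topologicalLmodType K)
    (f : 'rV[R]_n -> R^o) (g : 'rV[R]_n -> E) k s a b :
  @has_pder R (real_ground R) n R^o f k s a -> has_pder g k s b ->
  has_pder (fun s => of_real K (f s) *: g s) k s
    (of_real K a *: g s + of_real K (f s) *: b).
Proof.
move=> fa gb; rewrite /has_pder /real_quotient.
have fa' : of_real K (@real_quotient R (real_ground R) n R^o f k s h)
    @[h --> (0 : R)^'] --> (of_real K a : K^o).
  by apply: continuous_cvg fa; exact: of_real_continuous.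
apply: cvg_trans; last exact: (tvs_cvgD (tvs_cvgZ fa' (has_pder_line gb))
  (tvs_cvgZr (k := of_real K (f s)) gb)).
apply: near_eq_cvg; near=> h.
rewrite /real_quotient /= [_ *: (f _ - f s)]/GRing.scale/=.
rewrite rmorphM fmorphV rmorphB/= -scalerA scalerBl.
rewrite [of_real K (f s) *: (_ *: _)]scalerA [of_real K (f s) * _]mulrC.
by rewrite -scalerA -scalerDr scalerBr addrA subrK.
Unshelve. all: by end_near. Qed.

Lemma has_pderM (R : realType) n (f g : 'rV[R]_n -> R^o) k s a b :
  @has_pder R (real_ground R) n R^o f k s a ->
  @has_pder R (real_ground R) n R^o g k s b ->
  @has_pder R (real_ground R) n R^o (fun s => f s * g s) k s (a * g s + f s * b).
Proof. exact: (@has_pderZ R (real_ground R) n R^o). Qed.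

(** * Equality of mixed partial derivatives *)

Section MeanValuePartial.
Context {R : realType} {K : ground_field R} {A : tvsType K}.

Lemma mean_value_pder n (f D : 'rV[R]_n -> A) (C : set A) k s h :
  0 < h -> real_convex C ->
  (forall r, 0 <= r <= h ->
     has_pder f k (s + r *: delta_mx 0 k) (D (s + r *: delta_mx 0 k))) ->
  (forall r, 0 <= r <= h -> nbhs (D (s + r *: delta_mx 0 k)) C) ->
  C ((of_real K h)^-1 *: (f (s + h *: delta_mx 0 k) - f s)).
Proof.
move=> h0 convC fD DC.
have := @mean_value R K A (fun r => f (s + r *: delta_mx 0 k))
  (fun r => D (s + r *: delta_mx 0 k)) C 0 h h0 convC.
rewrite subr0 scale0r addr0; apply => // r /fD.
apply: cvg_trans; apply: near_eq_cvg; near=> t.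
by rewrite /real_quotient scalerDl addrA.
Unshelve. all: by end_near. Qed.

Lemma near_two_lines n (s : 'rV[R]_n) (u v : 'rV[R]_n) (P : set 'rV[R]_n) :
  nbhs s P -> exists2 e : R, 0 < e &
    forall a b, `|a| < e -> `|b| < e -> P (s + a *: u + b *: v).
Proof.
move=> sP.
have c : (s + p.1 *: u + p.2 *: v) @[p --> ((0 : R), (0 : R))] --> s.
  have {2}-> : s = s + (0 : R) *: u + (0 : R) *: v by rewrite !scale0r !addr0.
  apply: cvgD; last by apply: cvgZr_tmp; exact: cvg_snd.
  by apply: cvgD; [exact: cvg_cst|apply: cvgZr_tmp; exact: cvg_fst].
have [[B1 B2] /= [/nbhs_ballP[e1 /= e10 eB1] /nbhs_ballP[e2 /= e20 eB2]] BP] := c _ sP.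
exists (Num.min e1 e2); first by rewrite lt_min e10.
move=> a b; rewrite !lt_min => /andP[ae1 _] /andP[_ be2].
by apply: (BP (a, b)); split; [apply: eB1|apply: eB2];
  rewrite -ball_normE /ball_/= sub0r normrN.
Qed.

(* Both mixed partial derivatives are limits of this second difference, which is
   symmetric in [k] and [l]. *)
Lemma second_difference_cvg n (f g H : 'rV[R]_n -> A) k l s (U : set 'rV[R]_n) :
  nbhs s U -> (forall t, U t -> has_pder f k t (g t)) ->
  (forall t, U t -> has_pder g l t (H t)) -> {for s, continuous H} ->
  (of_real K h)^-1 *: ((of_real K h)^-1 *:
    (f (s + h *: delta_mx 0 k + h *: delta_mx 0 l) - f (s + h *: delta_mx 0 k)
     - (f (s + h *: delta_mx 0 l) - f s)))
  @[h --> (0 : R)^'+] --> H s.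
Proof.
move=> sU fg gH cH V /tvs_convex_nbhs[C [convC openC Cs CV]].
have [|e e0 UHC] := @near_two_lines _ s (delta_mx 0 k) (delta_mx 0 l)
    [set t | U t /\ C (H t)].
  by apply: filterI => //; apply: cH; exact: open_nbhs_nbhs.
apply: (@filterS _ _ _ _ _ CV); rewrite !near_simpl; near=> h.
have h0 : 0 < h by [].
have he : h < e by near: h; exact: nbhs_right_lt.
have small r : 0 <= r <= h -> `|r| < e.
  by move=> /andP[r0 rh]; rewrite ger0_norm// (le_lt_trans rh).
have h_small : `|h| < e by apply: small; rewrite lexx ltW.
(* The mean value theorem is used twice: along k for the quotient [q] of [f] in the direction l,
   whose derivative is the quotient [dq] of [g], and then along l for [g], whose derivative [H]
   takes its values in [C]. *)
pose q t := (of_real K h)^-1 *: (f (t + h *: delta_mx 0 l) - f t).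
pose dq t := (of_real K h)^-1 *: (g (t + h *: delta_mx 0 l) - g t).
have := @mean_value_pder _ q dq C k s h h0 convC.
rewrite /q -scalerBr; apply.
  move=> r /small rh; apply: has_pderZr; apply: has_pderB; last first.
    apply: fg; rewrite -[_ + _]addr0 -(scale0r (delta_mx 0 l)).
    by apply: (UHC _ _ _ _).1; rewrite ?normr0.
  have := fg _ (UHC _ _ rh h_small).1.
  apply: cvg_trans; apply: near_eq_cvg; near=> u.
  by rewrite /real_quotient; congr (_ *: (f _ - _)); rewrite addrAC.
move=> r /small rh; apply: open_nbhs_nbhs; split=> //.
apply: (@mean_value_pder _ g H) => // u /small uh.
  by apply: gH; exact: (UHC _ _ rh uh).1.
by apply: open_nbhs_nbhs; split=> //; exact: (UHC _ _ rh uh).2.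
Unshelve. all: by end_near. Qed.

Lemma mixed_partials n (f fk fl fkl flk : 'rV[R]_n -> A) k l s (U : set 'rV[R]_n) :
  hausdorff_space A -> nbhs s U ->
  (forall t, U t -> has_pder f k t (fk t)) ->
  (forall t, U t -> has_pder f l t (fl t)) ->
  (forall t, U t -> has_pder fk l t (fkl t)) ->
  (forall t, U t -> has_pder fl k t (flk t)) ->
  {for s, continuous fkl} -> {for s, continuous flk} -> fkl s = flk s.
Proof.
move=> hA sU dk dl dkl dlk ckl clk.
have c1 := second_difference_cvg sU dk dkl ckl.
have c2 := second_difference_cvg sU dl dlk clk.
apply: (cvg_unique hA c1); apply: cvg_trans c2; apply: near_eq_cvg.
near=> h; congr (_ *: (_ *: _)); rewrite [s + _ + _]addrAC !opprB.
by rewrite addrACA [RHS]addrACA; congr (_ + _); rewrite addrC.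
Unshelve. all: by end_near. Qed.

End MeanValuePartial.


(** * The chain rule for weakly differentiable maps *)

Section ChainRule.
Context {R : realType} {K : ground_field R}.

(** The jet spaces [E * ('I_4 -> E)] are used as [preTopologicalLmodType], where the topology and
    the operations are unrelated. This is the one compatibility that the chain rule asks for, and it
    passes to products and powers. *)
Definition line_continuous (E : preTopologicalLmodType K) := forall x v : E,
  (x + p.1 *: p.2 : E) @[p --> ((0 : K^o), v)] --> x.

Lemma line_continuous_tvs (E : topologicalLmodType K) : line_continuous E.
Proof.
move=> x v; rewrite -[X in _ --> X]addr0 -[X in x + X](scale0r v).
apply: tvs_cvgD; first exact: cvg_cst.
by apply: tvs_cvgZ; [exact: cvg_fst|exact: cvg_snd].
Qed.

Lemma line_continuous_prod (E F : preTopologicalLmodType K) :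
  line_continuous E -> line_continuous F -> line_continuous (E * F)%type.
Proof.
move=> cE cF [x y] [u v].
have lim1 : (p.1, p.2.1) @[p --> ((0 : K^o), (u, v))] --> ((0 : K^o), u).
  apply: (@cvg_pair _ _ _ _ (nbhs (0 : K^o)) (nbhs u)); first exact: cvg_fst.
  exact: (cvg_comp _ _ (cvg_snd (F := nbhs (0 : K^o))) (cvg_fst (F := nbhs u))).
have lim2 : (p.1, p.2.2) @[p --> ((0 : K^o), (u, v))] --> ((0 : K^o), v).
  apply: (@cvg_pair _ _ _ _ (nbhs (0 : K^o)) (nbhs v)); first exact: cvg_fst.
  exact: (cvg_comp _ _ (cvg_snd (F := nbhs (0 : K^o))) (cvg_snd (F := nbhs u))).
have ce := cvg_comp _ _ lim1 (cE x u).
have cf := cvg_comp _ _ lim2 (cF y v).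
exact: (cvg_pair ce cf).
Qed.

Import ArrowAsProduct.

Lemma cvg_arrow (T : Type) (F : set_system T) (FF : Filter F) n
    (E : topologicalType) (f : T -> 'I_n -> E) (l : 'I_n -> E) :
  (forall i, f t i @[t --> F] --> l i) -> f @ F --> l.
Proof.
move=> fl; apply/cvg_sup => i U [V [[W oW WV] Vl] VU].
apply: (filterS (P := f @^-1` V)); first by move=> t; exact: VU.
rewrite -WV; apply: (fl i W); apply: open_nbhs_nbhs; split=> //.
by move: Vl; rewrite -WV.
Qed.

Lemma line_continuous_arrow n (E : preTopologicalLmodType K) :
  line_continuous E -> line_continuous ('I_n -> E).
Proof.
move=> cE x v; apply: cvg_arrow => i.
have lim : (p.1, p.2 i) @[p --> ((0 : K^o), v)] --> ((0 : K^o), v i).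
  apply: (@cvg_pair _ _ _ _ (nbhs (0 : K^o)) (nbhs (v i))); first exact: cvg_fst.
  exact: (cvg_comp _ (fun w : 'I_n -> E => w i)
    (cvg_snd (F := nbhs (0 : K^o))) (@proj_continuous _ (fun=> E) i v)).
exact: (cvg_comp _ _ lim (cE (x i) (v i))).
Qed.

(* With [q] the difference quotient of [c], [f (c h) - f (c 0)] is an increment of
   [t |-> f (c 0 + t q)] on the segment between [0] and [h]: this needs no
   topology on [E] beyond continuity of [x + k *: q]. *)
Lemma chain_rule (E : preTopologicalLmodType K) (A : tvsType K) (f : E -> A)
    (df : E -> E -> A) (c : R -> E) (v : E) :
  line_continuous E ->
  (forall x v, quotient f x v h @[h --> (0 : K)^'] --> df x v) ->
  continuous (fun p : E * E => df p.1 p.2) ->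
  (of_real K h)^-1 *: (c h - c 0) @[h --> (0 : R)^'] --> v ->
  (of_real K h)^-1 *: (f (c h) - f (c 0)) @[h --> (0 : R)^'] --> df (c 0) v.
Proof.
move=> cE fdf cdf cv V /tvs_convex_nbhs[C [convC openC Cd CV]].
set x := c 0 in Cd cv *; apply: (filterS CV); rewrite /= !near_simpl.
(* The direction q of the increment varies with h and only tends to v, so point and direction move
   at once: joint continuity of the derivative enters here. *)
have near_C : \forall p \near ((0 : K^o), v), C (df (x + p.1 *: p.2) p.2).
  have lim : (x + p.1 *: p.2, p.2) @[p --> ((0 : K^o), v)] --> (x, v).
    by apply: (@cvg_pair _ _ _ _ (nbhs x) (nbhs v)); [exact: cE|exact: cvg_snd].
  have := cvg_comp _ (fun p => df p.1 p.2) lim (cdf (x, v)).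
  by apply; exact: open_nbhs_nbhs.
have [[B1 B2] /= [B1_0 B2v] BC] := near_C.
have [d /= d0 dB] : exists2 d : R, 0 < d & forall r : R, `|r| < d -> B1 (of_real K r).
  have := @of_real_continuous R K 0; rewrite /continuous_at rmorph0 => /(_ _ B1_0).
  move=> /nbhs_ballP[d /= d0 dB]; exists d => // r rd; apply: dB.
  by rewrite -ball_normE /ball_/= sub0r normrN.
near=> h.
have h0 : h != 0 by near: h; exact: nbhs_dnbhs_neq.
have hd : `|h| < d.
  near: h; apply: nbhs_dnbhs; apply/nbhs_ballP; exists d => // r.
  by rewrite -ball_normE /ball_/= sub0r normrN.
have : B2 ((of_real K h)^-1 *: (c h - x)) by near: h; exact: (cv _ B2v).
set q := _ *: _ => B2q.
have -> : c h = x + of_real K h *: q.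
  by rewrite scalerA divff ?scale1r ?[x + _]addrC ?subrK// fmorph_eq0.
pose phi t := f (x + of_real K t *: q).
have phi0 : phi 0 = f x by rewrite /phi rmorph0 scale0r addr0.
have dphi t : real_derivative phi t (df (x + of_real K t *: q) q).
  have := cvg_comp _ _ (@of_real_dnbhs R K) (fdf (x + of_real K t *: q) q).
  apply: cvg_trans; apply: near_eq_cvg; near=> u.
  by rewrite /phi /quotient /= rmorphD scalerDl addrA.
have dC t : `|t| <= `|h| -> nbhs (df (x + of_real K t *: q) q) C.
  move=> th; apply: open_nbhs_nbhs; split=> //.
  by apply: (BC (of_real K t, q)); split=> //=; apply: dB; exact: le_lt_trans hd.
rewrite -phi0 -/(phi h).
(* [mean_value] takes ordered end points, so a negative h uses the interval [h, 0], which has the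
   same quotient. *)
move: h0; rewrite neq_lt => /orP[h0|h0].
  have := @mean_value R K A phi _ C h 0 h0 convC (fun t _ => dphi t).
  rewrite sub0r rmorphN invrN scaleNr -scalerN opprB; apply=> t /andP[ht t0].
  by apply: dC; rewrite (ler0_norm t0) (ltr0_norm h0) lerN2.
have := @mean_value R K A phi _ C 0 h h0 convC (fun t _ => dphi t).
rewrite subr0; apply=> t /andP[t0 ht].
by apply: dC; rewrite (ger0_norm t0) (gtr0_norm h0).
Unshelve. all: by end_near. Qed.

Lemma has_pder_comp n (E : preTopologicalLmodType K) (A : tvsType K) (f : E -> A)
    (df : E -> E -> A) (c : 'rV[R]_n -> E) k s (v : E) :
  line_continuous E ->
  (forall x v, quotient f x v h @[h --> (0 : K)^'] --> df x v) ->
  continuous (fun p : E * E => df p.1 p.2) ->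
  has_pder c k s v -> has_pder (fun t => f (c t)) k s (df (c s) v).
Proof.
move=> cE fdf cdf cv.
have := @chain_rule E A f df (fun h => c (s + h *: delta_mx 0 k)) v cE fdf cdf.
by rewrite scale0r addr0; exact.
Qed.

End ChainRule.


(** * Riemann sums and Stokes' theorem on a cube *)

Section Reindexing.

Lemma ord_mul_subproof N N' (j : 'I_N) (r : 'I_N') : (j * N' + r < N * N')%N.
Proof.
apply: (@leq_trans (j.+1 * N')); first by rewrite mulSn addnC ltn_add2r.
by rewrite leq_mul2r ltn_ord orbT.
Qed.

Definition ord_mul N N' (j : 'I_N) (r : 'I_N') : 'I_(N * N') :=
  Ordinal (ord_mul_subproof j r).

(** Euclidean division by N' in each coordinate: an index of the refined grid is an index of the
    coarse grid together with a position inside its cell. *)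
Lemma sum_ffun_mul (V : zmodType) d N N' (F : {ffun 'I_d -> 'I_(N * N')} -> V) :
  \sum_k F k = \sum_(p : {ffun 'I_d -> 'I_N} * {ffun 'I_d -> 'I_N'})
    F [ffun l => ord_mul (p.1 l) (p.2 l)].
Proof.
have div_proof (k : 'I_(N * N')) : (k %/ N' < N)%N.
  have N'0 : (0 < N')%N by case: (N') k => // -[m]; rewrite muln0.
  by rewrite ltn_divLR.
have mod_proof (k : 'I_(N * N')) : (k %% N' < N')%N.
  by case: (N') k => [[m]|N'0 k]; rewrite ?muln0 ?ltn_mod.
rewrite (reindex (fun p : {ffun 'I_d -> 'I_N} * {ffun 'I_d -> 'I_N'} =>
  [ffun l => ord_mul (p.1 l) (p.2 l)])) //=.
exists (fun k => ([ffun l => Ordinal (div_proof (k l))],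
                  [ffun l => Ordinal (mod_proof (k l))])) => [[j r] _|k _] /=.
  congr pair; apply/ffunP => l; apply/val_inj; rewrite !ffunE /=.
    rewrite divnMDl ?divn_small ?addn0//.
    by apply: leq_ltn_trans (ltn_ord (r l)).
  by rewrite modnMDl modn_small.
by apply/ffunP => l; apply/val_inj; rewrite !ffunE /= -divn_eq.
Qed.

Definition insert_ord d (T : Type) (l : 'I_d.+1) (x : T) (k : 'I_d -> T)
    (j : 'I_d.+1) : T :=
  if unlift l j is Some j' then k j' else x.

Lemma sum_ffun_insert (V : zmodType) d (I : finType) (l : 'I_d.+1)
    (F : {ffun 'I_d.+1 -> I} -> V) :
  \sum_k F k = \sum_(p : {ffun 'I_d -> I} * I) F [ffun j => insert_ord l p.2 p.1 j].
Proof.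
rewrite (reindex (fun p : {ffun 'I_d -> I} * I => [ffun j => insert_ord l p.2 p.1 j]))//=.
exists (fun k => ([ffun j => k (lift l j)], k l)) => [[k x] _|k _] /=.
  congr pair; last by rewrite ffunE /insert_ord unlift_none.
  by apply/ffunP => j; rewrite !ffunE /insert_ord liftK.
apply/ffunP => j; rewrite ffunE /insert_ord.
by case: unliftP => [j' ->|->]//; rewrite ffunE.
Qed.

End Reindexing.

Section Riemann.
Context {R : realType} {K : ground_field R} {A : quantum_superalgebra K}.

Definition grid d N (k : {ffun 'I_d -> 'I_N}) : 'rV[R]_d :=
  \row_l ((k l)%:R / N%:R).

Definition riemann_sum d (f : 'rV[R]_d -> A) (N : nat) : A :=
  N%:R ^- d *: \sum_(k : {ffun 'I_d -> 'I_N}) f (grid k).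

Lemma cube_grid d N (k : {ffun 'I_d -> 'I_N}) : cube (grid k).
Proof.
move=> l; rewrite mxE divr_ge0 ?ler0n//= ler_pdivrMr ?mul1r ?ler_nat ?ltr0n.
  exact: ltnW.
exact: leq_ltn_trans (ltn_ord (k l)).
Qed.

Lemma tvs_split (B : set A) : nbhs 0 B ->
  exists2 C, nbhs 0 C & forall x y, C x -> C y -> B (x - y).
Proof.
move=> B0; have := @sub_continuous A (0, 0) B; rewrite /= subr0 => /(_ B0).
move=> [[C1 C2] /= [C10 C20] CB]; exists (C1 `&` C2); first exact: filterI.
by move=> x y [Cx _] [_ Cy]; exact: (CB (x, y)).
Qed.

(** Stated with neighbourhoods of 0, to be combined with convex sets, and for points of the cube
    only, since integrands are controlled only there. *)
Definition uniform_on_cube d (f : 'rV[R]_d -> A) := forall B : set A, nbhs 0 B ->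
  exists2 e : R, 0 < e & forall s t, cube s -> cube t ->
    (forall l, `|s 0 l - t 0 l| < e) -> B (f s - f t).

Lemma cube_compact d : compact (@cube R d).
Proof.
have := @rV_compact R d (fun=> `[0, 1]%classic) (fun=> @segment_compact R 0 1).
by congr compact; apply/seteqP; split=> s sc k; have := sc k; rewrite /= in_itv.
Qed.

(** The Heine-Cantor theorem, with compactness used in its near-covering form to obtain one radius
    for all points. *)
Lemma uniform_on_cube_continuous d (f : 'rV[R]_d -> A) :
  (forall s, cube s -> {for s, continuous f}) -> uniform_on_cube f.
Proof.
move=> cf B B0; have [C C0 CB] := tvs_split B0.
have /compact_near_coveringP/near_covering_withinP cov := @cube_compact d.
have loc (x : 'rV[R]_d) : cube x -> exists2 e : R, 0 < e &
    forall t : 'rV[R]_d, (forall l, `|t 0 l - x 0 l| < e) -> C (f t - f x).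
  move=> xc.
  have sub_cvg : (f t - f x) @[t --> x] --> (0 : A).
    rewrite -[X in _ --> X](subrr (f x)).
    by apply: (tvs_cvgB (F := nbhs x)); [exact: cf|exact: cvg_cst].
  have /nbhs_ballP[e /= e0 eC] := sub_cvg _ C0.
  exists e => // t tx; apply: eC; split=> [|i j]; first exact: e0.
  rewrite ord1 -ball_normE /ball_/=.
  by rewrite distrC.
have := cov R (0 : R)^'+ (fun e (s : 'rV[R]_d) => forall t : 'rV[R]_d, cube t ->
  (forall l, `|t 0 l - s 0 l| < e) -> B (f t - f s)).
case=> //.
  move=> x /loc[e e0 eC].
  (* Half of the radius at x is left for the move from x to s and half for the move from s to t. *)
  exists (ball x (e / 2), [set d | d < e / 2]).
    split; first by apply: nbhsx_ballx; rewrite divr_gt0.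
    by apply: nbhs_right_lt; rewrite divr_gt0.
  move=> [s r] /= [xs re] _ t tc ts; rewrite -(subrKA (f x)) -[f x - _]opprB.
  have xs' l : `|x 0 l - s 0 l| < e / 2.
    by have := xs.2 0 l; rewrite -ball_normE.
  apply: CB; apply: eC => l; last first.
    by rewrite distrC (lt_trans (xs' l))// ltr_pdivrMr// ltr_pMr// ltr1n.
  have -> : t 0 l - x 0 l = (t 0 l - s 0 l) - (x 0 l - s 0 l) by ring.
  rewrite (le_lt_trans (ler_normB _ _))// [e]splitr ltrD//.
  exact: lt_trans (ts l) re.
move=> e /= e0 eP; exists (e / 2); first by rewrite divr_gt0.
move=> s t sc tc st; apply: (eP (e / 2)) => //=.
  by rewrite sub0r normrN gtr0_norm ?divr_gt0// ltr_pdivrMr// ltr_pMr// ltr1n.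
by rewrite divr_gt0.
Qed.

(* Two Riemann sums are compared through their common refinement. *)
Lemma riemann_refine d (f : 'rV[R]_d -> A) : uniform_on_cube f ->
  forall B : set A, nbhs 0 B -> \forall N \near \oo, forall N', (0 < N')%N ->
    B (riemann_sum f (N * N') - riemann_sum f N).
Proof.
move=> uf B /tvs_convex_nbhs[C [convC openC C0 CB]].
have [e e0 eC] := uf C (open_nbhs_nbhs (conj openC C0)).
near=> N => N' N'0; apply: CB.
have N0 : (0 < N)%N by near: N; exists 1%N.
have Ne : N%:R^-1 < e.
  rewrite -[e]invrK ltf_pV2 ?posrE ?invr_gt0 ?ltr0n//.
  by near: N; exact: nbhs_infty_gtr.
pose P := ({ffun 'I_d -> 'I_N} * {ffun 'I_d -> 'I_N'})%type.
have P_card : #|{: P}| = ((N * N') ^ d)%N.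
  by rewrite card_prod !card_ffun !card_ord expnMn.
have P0 : (0 < #|{: P}|)%N by rewrite P_card expn_gt0 muln_gt0 N0 N'0.
have N_neq0 : N%:R != 0 :> K by rewrite pnatr_eq0 -lt0n.
have N'_neq0 : N'%:R != 0 :> K by rewrite pnatr_eq0 -lt0n.
(* Each coarse value is repeated N'^d times. The difference becomes the mean, over the refined grid,
   of the variation of f between a point and the corner of its coarse cell, at distance less than 1
   / N in each coordinate. *)
have -> : riemann_sum f (N * N') - riemann_sum f N = #|{: P}|%:R^-1 *:
    \sum_(p : P) (f (grid [ffun l => ord_mul (p.1 l) (p.2 l)]) - f (grid p.1)).
  rewrite sumrB scalerBr P_card natrX; congr (_ - _).
    by rewrite /riemann_sum sum_ffun_mul.
  rewrite -(pair_bigA _ (fun j (r : {ffun 'I_d -> 'I_N'}) => f (grid j)))/=.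
  under eq_bigr do rewrite sumr_const card_ffun !card_ord -scaler_nat.
  rewrite -scaler_sumr scalerA natrX natrM exprMn invfM -mulrA mulVf ?mulr1//.
  by rewrite expf_neq0.
apply: real_convex_sum => // -[j r] /=; apply: eC; [exact: cube_grid..|].
move=> l; rewrite !mxE ffunE /= natrD !natrM.
have N_neq0R : N%:R != 0 :> R by rewrite pnatr_eq0 -lt0n.
have N'_neq0R : N'%:R != 0 :> R by rewrite pnatr_eq0 -lt0n.
have -> : ((j l)%:R * N'%:R + (r l)%:R) / (N%:R * N'%:R) - (j l)%:R / N%:R
    = ((r l)%:R / N'%:R) / N%:R :> R by field; rewrite N_neq0R.
rewrite ger0_norm ?divr_ge0 ?ler0n//; apply: le_lt_trans Ne.
by rewrite ler_piMl ?invr_ge0 ?ler0n// ler_pdivrMr ?ltr0n// mul1r ler_nat ltnW.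
Unshelve. all: by end_near. Qed.

Lemma riemann_cauchy d (f : 'rV[R]_d -> A) :
  uniform_on_cube f -> cauchy (riemann_sum f @ \oo).
Proof.
move=> uf V /(@frechet_add_unif_continuous K A) /= [[V1 V2] /= [entV1 entV2] V12].
have : nbhs (0 : A) [set x | V1 (x, 0)].
  have := nbhs_entourage (0 : A) (entourage_inv entV1).
  by apply: filterS => x /xsectionP.
move=> /tvs_split[B B0 BV1]; have near_B := riemann_refine uf B0.
pose G := [set a | exists N, [/\ (0 < N)%N, a = riemann_sum f N &
  forall N', (0 < N')%N -> B (riemann_sum f (N * N') - riemann_sum f N)]].
have G_near : \forall N \near \oo, G (riemann_sum f N).
  near=> N; exists N; split=> //; first by near: N; exists 1%N.
  by near: N; exact: near_B.
exists (G, G); first by [].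
move=> [_ _] [/= [N [N0 -> BN]] [N' [N'0 -> BN']]].
set a := riemann_sum f N; set b := riemann_sum f N'.
have V1ab : V1 (a - b, 0).
  have -> : a - b = (riemann_sum f (N * N') - b) - (riemann_sum f (N * N') - a).
    by rewrite opprB [RHS]addrC subrKA.
  by apply: BV1; [rewrite mulnC; exact: BN'|exact: BN].
(* Adding b to both members of (a - b, 0) gives (a, b); uniform continuity of the addition thus
   turns closeness of a - b to 0 into an entourage. *)
have : (V1 `*` V2) ((a - b, 0), (b, b)) by split=> //; exact: entourage_refl.
move=> /V12[[[x y] [z w]] /= + [xE zE yE wE]].
by rewrite xE yE zE wE subrK add0r.
Unshelve. all: by end_near. Qed.

Lemma riemann_cvg d (f : 'rV[R]_d -> A) :
  uniform_on_cube f -> riemann_sum f @ \oo --> cube_integral f.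
Proof.
move=> uf; have [l fl] := frechet_complete _ _ (riemann_cauchy uf).
by rewrite /cube_integral (limit_eq _ _ fl)//; exact: frechet_hausdorff.
Qed.


(** For x = 0 or 1 this is, up to conversion, the point at which [face] evaluates its cube. *)
Definition insert_coord d (l : 'I_d.+1) (x : R) (s : 'rV[R]_d) : 'rV[R]_d.+1 :=
  \row_j insert_ord l x (s 0) j.

Lemma cube_insert d (l : 'I_d.+1) (x : R) (s : 'rV[R]_d) :
  0 <= x <= 1 -> cube s -> cube (insert_coord l x s).
Proof.
by move=> x01 sc j; rewrite mxE /insert_ord; case: unliftP => [j' _|_] //; exact: sc.
Qed.

Lemma insert_coordD d (l : 'I_d.+1) (x y : R) (s : 'rV[R]_d) :
  insert_coord l x s + y *: delta_mx 0 l = insert_coord l (x + y) s.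
Proof.
apply/rowP => j; rewrite !mxE /insert_ord eqxx /=.
by case: unliftP => [j' ->|->]; rewrite ?eqxx ?mulr1// eq_sym eq_liftF mulr0 addr0.
Qed.

Lemma uniform_on_face d (f : 'rV[R]_d.+1 -> A) l x : 0 <= x <= 1 ->
  uniform_on_cube f -> uniform_on_cube (fun s => f (insert_coord l x s)).
Proof.
move=> x01 uf B /uf[e e0 eB]; exists e => // s t sc tc st.
apply: eB; [exact: cube_insert..|] => j; rewrite !mxE /insert_ord.
by case: unliftP => [j' _|_]; rewrite ?subrr ?normr0.
Qed.

(** On each grid line in the direction l the forward differences of step 1 / N telescope from 0 to
    1. The factor N makes them difference quotients and compensates for N^-(d+1) in place of
    N^-d. *)
Lemma riemann_telescope d (f : 'rV[R]_d.+1 -> A) (l : 'I_d.+1) N : (0 < N)%N ->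
  riemann_sum (fun s => f (insert_coord l 1 s)) N
    - riemann_sum (fun s => f (insert_coord l 0 s)) N =
  N%:R ^- d.+1 *: \sum_(k : {ffun 'I_d.+1 -> 'I_N})
    N%:R *: (f (grid k + N%:R^-1 *: delta_mx 0 l) - f (grid k)).
Proof.
move=> N0; rewrite -scaler_sumr scalerA exprS invfM mulrAC mulVf; last first.
  by rewrite pnatr_eq0 -lt0n.
rewrite mul1r -scalerBr -sumrB; congr (_ *: _).
have gridE (k : {ffun 'I_d -> 'I_N}) (x : 'I_N) :
    grid [ffun j => insert_ord l x k j] = insert_coord l (x%:R / N%:R) (grid k).
  apply/rowP => j; rewrite !mxE ffunE /insert_ord.
  by case: unliftP => [j' _|_] //; rewrite mxE.
rewrite (sum_ffun_insert l).
rewrite -(pair_bigA _ (fun (k : {ffun 'I_d -> 'I_N}) (x : 'I_N) =>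
  f (grid [ffun j => insert_ord l x k j] + N%:R^-1 *: delta_mx 0 l)
  - f (grid [ffun j => insert_ord l x k j])))/=.
apply: eq_bigr => k _.
pose F (x : nat) := f (insert_coord l (x%:R / N%:R) (grid k)).
under eq_bigr => x _.
  rewrite gridE insert_coordD.
  rewrite (_ : _ + _^-1 = x.+1%:R / N%:R); last by rewrite -natr1 mulrDl mul1r.
  rewrite -/(F x) -/(F x.+1).
  over.
rewrite -(big_mkord xpredT (fun x => F x.+1 - F x)) telescope_sumr//.
by rewrite /F mul0r divff// pnatr_eq0 -lt0n.
Qed.

End Riemann.


(** * Stokes' theorem on a cube *)

Section Stokes.
Context {R : realType} {K : ground_field R} {A : quantum_superalgebra K}.

Lemma real_convex_translate (E : lmodType K) (C : set E) (c : E) :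
  real_convex C -> real_convex [set x | C (x - c)].
Proof.
move=> convC x y t t01 /= Cx Cy.
have := convC _ _ _ t01 Cx Cy; congr C.
rewrite !scalerBr addrACA -opprD -scalerDl -rmorphD [t + _]addrC subrK.
by rewrite rmorph1 scale1r.
Qed.

(** The mean value theorem is applied with the translate of [C] by [df (grid k)]; uniform continuity
    of [df] makes the bound on N independent of k. *)
Lemma difference_quotient_near d (f df : 'rV[R]_d -> A) l (C : set A) :
  (forall s, cube s -> has_pder f l s (df s)) -> uniform_on_cube df ->
  nbhs 0 C -> real_convex C -> open C ->
  \forall N \near \oo, forall k : {ffun 'I_d -> 'I_N},
    C (N%:R *: (f (grid k + N%:R^-1 *: delta_mx 0 l) - f (grid k)) - df (grid k)).
Proof.
move=> fdf udf C0 convC openC; have [e e0 eC] := udf C C0.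
near=> N => k.
have N0 : (0 < N)%N by near: N; exists 1%N.
have Ne : N%:R^-1 < e.
  rewrite -[e]invrK ltf_pV2 ?posrE ?invr_gt0 ?ltr0n//.
  by near: N; exact: nbhs_infty_gtr.
(* Grid points are lower corners of cells, so k + 1 is at most N and the segment of length 1 / N
   stays in the cube. *)
have on_cube (r : R) : 0 <= r <= N%:R^-1 -> cube (grid k + r *: delta_mx 0 l).
  move=> /andP[r0 rN] j; rewrite !mxE eqxx /=; have := ltn_ord (k j).
  rewrite -(ler_nat R) -natr1 => kN.
  have kN1 : (k j)%:R / N%:R + N%:R^-1 <= 1 :> R.
    by rewrite -[X in _ + X]mul1r -mulrDl ler_pdivrMr ?mul1r// ltr0n.
  have k0 : 0 <= (k j)%:R / N%:R :> R by rewrite divr_ge0 ?ler0n.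
  have N'0 : 0 <= N%:R^-1 :> R by rewrite invr_ge0 ler0n.
  by case: eqP => _ /=; rewrite ?mulr1 ?mulr0 ?addr0; apply/andP; split; lra.
have N_inv0 : 0 < N%:R^-1 :> R by rewrite invr_gt0 ltr0n.
have := @mean_value_pder _ _ _ _ f df _ l (grid k) N%:R^-1 N_inv0
  (real_convex_translate (c := df (grid k)) convC).
rewrite fmorphV invrK rmorph_nat; apply=> r rN; first exact/fdf/on_cube.
have : (x - df (grid k)) @[x --> df (grid k + r *: delta_mx 0 l)] -->
    df (grid k + r *: delta_mx 0 l) - df (grid k).
  by apply: tvs_cvgB; [exact: cvg_id|exact: cvg_cst].
apply; apply: open_nbhs_nbhs; split=> //.
apply: eC; [exact: on_cube|exact: cube_grid|] => j.
rewrite !mxE eqxx /= addrAC subrr add0r.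
move: rN => /andP[r0 rN]; case: eqP => _ /=; rewrite ?mulr1 ?mulr0 ?normr0//.
by rewrite (ger0_norm r0); exact: le_lt_trans rN Ne.
Unshelve. all: by end_near. Qed.

(** [W l] is the coefficient of a form with ds^l omitted. By telescoping, the alternating sum of the
    Riemann sums on faces is a mean over the grid of alternating sums of difference quotients, which
    are close to those of the derivatives, hence to 0. *)
Lemma stokes_cube d (W dW : 'I_d.+1 -> 'rV[R]_d.+1 -> A) :
  (forall l s, cube s -> has_pder (W l) l s (dW l s)) ->
  (forall l, uniform_on_cube (W l)) -> (forall l, uniform_on_cube (dW l)) ->
  (forall s, cube s -> \sum_(l < d.+1) (-1) ^+ l *: dW l s = 0) ->
  \sum_(l < d.+1) (-1) ^+ l *:
    (cube_integral (fun s => W l (insert_coord l 1 s))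
     - cube_integral (fun s => W l (insert_coord l 0 s))) = 0.
Proof.
move=> WdW uW udW dW0.
pose S N := \sum_(l < d.+1) (-1) ^+ l *:
  (riemann_sum (fun s => W l (insert_coord l 1 s)) N
   - riemann_sum (fun s => W l (insert_coord l 0 s)) N).
set T := \sum_(l < _) _.
have ST : S N @[N --> \oo] --> T.
  apply: tvs_cvg_sum => l _; apply: tvs_cvgZr; apply: tvs_cvgB;
    by apply: riemann_cvg; apply: uniform_on_face; rewrite ?lexx ?ler01.
suff S0 : S N @[N --> \oo] --> (0 : A) by exact: (cvg_unique frechet_hausdorff ST S0).
move=> V /tvs_convex_nbhs[C [convC openC C0 CV]].
(* An alternating sum of d + 1 terms is the mean of these terms multiplied by d + 1 or its opposite;
   [B] consists of the points for which both multiples lie in [C]. *)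
have [B [B0 convB openB BC]] : exists B : set A, [/\ nbhs 0 B, real_convex B, open B &
    forall c : 'I_d.+1 -> A, (forall l, B (c l)) -> C (\sum_(l < d.+1) (-1) ^+ l *: c l)].
  have cZ a : continuous (fun x : A => a *: x : A).
    by move=> x; apply: tvs_cvgZr; exact: cvg_id.
  have convZ a : real_convex [set x : A | C (a *: x)].
    move=> x y t t01 Cx Cy; have := convC _ _ _ t01 Cx Cy; congr C.
    by rewrite scalerDr !scalerA ![a * _]mulrC.
  have nbZ a : nbhs 0 [set x : A | C (a *: x)].
    by apply: (cZ a 0); rewrite scaler0; apply: open_nbhs_nbhs.
  exists [set x | C (d.+1%:R *: x) /\ C (- d.+1%:R *: x)]; split.
  - by apply: filterI; exact: nbZ.
  - by move=> x y t t01 [Cx C'x] [Cy C'y]; split; exact: convZ.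
  - by apply: openI; apply: open_comp openC => x _; exact: cZ.
  - move=> c Bc; have := @real_convex_sum _ _ _ C _
        (fun l : 'I_d.+1 => d.+1%:R *: ((-1) ^+ l *: c l)) _ convC.
    rewrite card_ord -scaler_sumr scalerA mulVf ?pnatr_eq0// scale1r; apply=> // l.
    have [Cl C'l] := Bc l; rewrite -signr_odd; case: odd; last by rewrite scale1r.
    by rewrite expr1 scaleN1r scalerN -scaleNr.
have near_B l := difference_quotient_near (WdW l) (udW l) B0 convB openB.
have near_all : \forall N \near \oo, forall l (k : {ffun 'I_d.+1 -> 'I_N}),
    B (N%:R *: (W l (grid k + N%:R^-1 *: delta_mx 0 l) - W l (grid k)) - dW l (grid k)).
  by apply: filter_forall near_B.
rewrite /= !near_simpl; near=> N.
have N0 : (0 < N)%N by near: N; exists 1%N.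
apply: CV; rewrite /S.
under eq_bigr do rewrite riemann_telescope// scalerA mulrC -scalerA scaler_sumr.
rewrite -scaler_sumr exchange_big /=.
have -> : N%:R ^- d.+1 = #|{: {ffun 'I_d.+1 -> 'I_N}}|%:R^-1 :> K.
  by rewrite card_ffun !card_ord natrX.
apply: real_convex_sum => // [|k]; first by rewrite card_ffun !card_ord expn_gt0 N0.
have nB := near near_all N; have := BC _ (fun l => nB _ l k); rewrite /=.
under eq_bigr do rewrite scalerBr.
rewrite sumrB dW0 ?subr0; last exact: cube_grid.
exact.
Unshelve. all: by end_near. Qed.

End Stokes.


(** * Integration on chains *)

Section Chains.
Context {R : realType} {K : ground_field R}.

(* [pder] is two-sided, so that at the boundary of the cube it involves values
   outside of the cube; one-sided limits still determine it when it exists. *)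
Lemma has_pder_unique_on_cube d (E : topologicalLmodType K) (f g : 'rV[R]_d -> E)
    k s a b :
  hausdorff_space E -> cube s -> has_pder f k s a -> has_pder g k s b ->
  (forall h, cube (s + h *: delta_mx 0 k) ->
     f (s + h *: delta_mx 0 k) = g (s + h *: delta_mx 0 k)) ->
  a = b.
Proof.
move=> hE sc fa gb fg.
have fgs : f s = g s by rewrite -[s]addr0 -(scale0r (delta_mx 0 k)) fg// scale0r addr0.
have moved h : 0 <= s 0 k + h <= 1 -> cube (s + h *: delta_mx 0 k).
  move=> kh j; rewrite !mxE eqxx /=; case: eqP => [->|_]; first by rewrite mulr1.
  by rewrite mulr0 addr0; exact: sc.
have conclude (F : set_system R) (FF : ProperFilter F) : F `=>` (0 : R)^' ->
    (\forall h \near F, cube (s + h *: delta_mx 0 k)) -> a = b.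
  move=> F0 Fc.
  have Fa : real_quotient f k s h @[h --> F] --> a by move=> U /fa; exact: F0.
  have Fb : real_quotient g k s h @[h --> F] --> b by move=> U /gb; exact: F0.
  apply: (cvg_unique hE Fa); apply: cvg_trans Fb; apply: near_eq_cvg.
  by apply: filterS Fc => h hc; rewrite /real_quotient fgs fg.
have /andP[s0 s1] := sc k.
(* Small positive increments stay in the cube unless s_k = 1, where negative ones do. *)
have [sk1|sk1] := ltP (s 0 k) 1.
  apply: (conclude (0 : R)^'+) => [U|].
    rewrite /dnbhs /at_right /within /=.
    by apply: filterS => x Ux x0; apply: Ux; rewrite gt_eqF.
  near=> h; apply: moved; apply/andP; split; first by rewrite addr_ge0.
  rewrite -lerBrDl; apply/ltW; near: h; apply: nbhs_right_lt.
  by rewrite subr_gt0.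
apply: (conclude (0 : R)^'-) => [U|].
  rewrite /dnbhs /at_left /within /=.
  by apply: filterS => x Ux x0; apply: Ux; rewrite lt_eqF.
near=> h; apply: moved; apply/andP; split; last first.
  by rewrite (le_trans _ s1)// gerDl ltW.
apply: (@le_trans _ _ (1 + h)); last by rewrite lerD2r.
rewrite -lerBlDl sub0r; apply/ltW; near: h; apply: nbhs_left_gt.
by rewrite oppr_lt0.
Unshelve. all: by end_near. Qed.

End Chains.

Section ChainIntegral.
Context {R : realType} {K : ground_field R} {A : quantum_superalgebra K}.
Context {m n : nat} {M : quantum_supermanifold A m n} {g : lie_superalgebra A}.
Context {i : embedding M} {E : fibred_coordinates g i}.

Local Notation cubes d := (@singular_cube _ _ _ _ _ _ _ _ E d).
Local Notation chains d := (@chain _ _ _ _ _ _ _ _ E d).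

Lemma cube_integral_eq d (f h : 'rV[R]_d -> A) :
  (forall s, cube s -> f s = h s) -> cube_integral f = cube_integral h.
Proof.
move=> fh; rewrite /cube_integral; congr limit; congr (_ @ \oo).
apply/funext => N; congr (_ *: _); apply: eq_bigr => k _.
by apply: fh; exact: cube_grid.
Qed.

Lemma cube_integral0 d (f : 'rV[R]_d -> A) :
  (forall s, cube s -> f s = 0) -> cube_integral f = 0.
Proof.
move=> f0; rewrite (@cube_integral_eq _ _ (cst 0))// /cube_integral.
apply: limit_eq; first exact: frechet_hausdorff.
by under eq_fun do rewrite big1// scaler0; exact: cvg_cst.
Qed.

(** Applied to c - c', it suffices that a chain with zero coefficients has sum 0. By induction on
    its length, all the terms equal to its first cube u on the cube are gathered: they contribute I
    u times the coefficient of u, hence 0, and removing them leaves the coefficients of the rest at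
    0. The predicate [good] carries the regularity under which [I] respects equality on the cube. *)
Lemma chain_sum_eq d (I : cubes d -> A) (good : cubes d -> Prop) (c c' : chains d) :
  (forall u u', good u -> good u' -> eq_cube u u' -> I u = I u') ->
  (forall u, good u -> degenerate u -> I u = 0) ->
  List.Forall (fun ku => good ku.2) c -> List.Forall (fun ku => good ku.2) c' ->
  chain_eq c c' ->
  \sum_(ku <- c) I ku.2 *~ ku.1 = \sum_(ku <- c') I ku.2 *~ ku.1.
Proof.
move=> Ieq Ideg gc gc' cc'.
have zero (N : nat) : forall e : chains d, (size e <= N)%N ->
    List.Forall (fun ku => good ku.2) e ->
    (forall u, ~ degenerate u -> coefficient e u = 0) ->
    \sum_(ku <- e) I ku.2 *~ ku.1 = 0.
  elim: N => [[|//] _ _ _|N IH [|[k u] r] sz ge ce]; rewrite ?big_nil//.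
  set e := _ :: r in sz ge ce *.
  pose p (ku : int * cubes d) := `[< eq_cube ku.2 u >].
  have gu : good u by inversion ge.
  rewrite (bigID p) /=.
  have -> : \sum_(ku <- e | p ku) I ku.2 *~ ku.1 = I u *~ coefficient e u.
    rewrite /coefficient -big_mkcond -/p [RHS]raddf_sum /=.
    elim: e ge {sz ce} => [|[k' v] e IHe] ge; first by rewrite !big_nil.
    inversion ge; subst; rewrite !big_cons IHe// /p.
    case: ifP => // /asboolP vu; by rewrite (Ieq v u).
  have -> : I u *~ coefficient e u = 0.
    by have [/Ideg->//|/ce->//] := pselect (degenerate u); rewrite mul0rz.
  rewrite add0r -big_filter; apply: IH.
  - have pu : p (k, u) by apply/asboolP.
    rewrite /= pu /= size_filter. apply: (leq_trans (count_size _ _)); exact: sz.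
  - elim: e ge {sz ce} => [|x e IHe] ge //=; inversion ge; subst.
    by case: ifP => // _; [constructor=> //|]; exact: IHe.
  - move=> v v_nd; rewrite /coefficient big_filter.
    have [vu|vu] := pselect (eq_cube v u).
      rewrite big1// => -[k' w] /= /asboolP wu; case: asboolP => // wv.
      by case: wu => s sc; rewrite /= wv// vu.
    rewrite -[RHS](ce v v_nd) /coefficient [in RHS](bigID p) /=.
    rewrite [X in _ = X + _]big1 ?add0r// => -[k' w] /asboolP /= wu.
    by case: asboolP => // wv; case: vu => s sc; rewrite -wv// wu.
have := zero _ (c ++ chain_opp c') (leqnn _).
rewrite big_cat /= /chain_opp big_map /= => H; apply/eqP; rewrite -subr_eq0 -sumrN.
apply/eqP; under [X in _ + X]eq_bigr do rewrite -mulrNz; apply: H.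
  apply/List.Forall_app; split=> //.
  elim: c' gc' {cc'} => [|x c' IH] gc' //=; inversion gc'; subst.
  by constructor=> //; exact: IH.
move=> u u_nd; rewrite /coefficient big_cat big_map /=.
have -> : \sum_(j <- c') (if `[< eq_cube j.2 u >] then - j.1 else 0) = - coefficient c' u.
  by rewrite /coefficient -sumrN; apply: eq_bigr => j _; case: ifP; rewrite ?oppr0.
by rewrite -(cc' u u_nd) subrr.
Qed.

End ChainIntegral.


(** * Pullbacks of 3-forms to cubes and to their faces *)

Section Pullback.
Context {R : realType} {K : ground_field R} {A : quantum_superalgebra K}.
Context {m n : nat} {M : quantum_supermanifold A m n} {g : lie_superalgebra A}.
Context {i : embedding M} {E : fibred_coordinates g i}.

Local Notation cubes d := (@singular_cube _ _ _ _ _ _ _ _ E d).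
Local Notation chains d := (@chain _ _ _ _ _ _ _ _ E d).

(** What the values of [dx] on the cube need in order to be meaningful; unlike the equations of an
    integral cube, it is all that has to be carried over to the faces in a boundary. *)
Definition base_differentiable d (u : cubes d) := forall s a k, cube s ->
  exists l, @has_pder R (real_ground R) d R^o (fun s => jx (u s) 0 a) k s l.

Lemma has_pder_dx d (u : cubes d) s a k : base_differentiable u -> cube s ->
  @has_pder R (real_ground R) d R^o (fun s => jx (u s) 0 a) k s (dx u a k s).
Proof. by move=> du sc; apply: has_pder_pder; exact: du. Qed.

Lemma smooth_cube_base_differentiable d (u : cubes d) :
  smooth_cube u -> base_differentiable u.
Proof.
move=> [U [_ cU [su _ _ _]]] s a k sc.
by have [_ /(_ k)[/(_ s (cU _ sc))]] := su a 1%N.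
Qed.

Lemma real_pder_unique_on_cube d (f h : 'rV[R]_d -> R^o) k s a b : cube s ->
  @has_pder R (real_ground R) d R^o f k s a ->
  @has_pder R (real_ground R) d R^o h k s b ->
  (forall r, cube (s + r *: delta_mx 0 k) ->
     f (s + r *: delta_mx 0 k) = h (s + r *: delta_mx 0 k)) ->
  a = b.
Proof.
apply: (@has_pder_unique_on_cube R (real_ground R) d R^o).
exact: norm_hausdorff.
Qed.

Lemma dx_eq_cube d (u u' : cubes d) s a k : base_differentiable u ->
  base_differentiable u' -> eq_cube u u' -> cube s -> dx u a k s = dx u' a k s.
Proof.
move=> du du' uu' sc.
apply: (real_pder_unique_on_cube sc (has_pder_dx (a := a) (k := k) du sc)
  (has_pder_dx (a := a) (k := k) du' sc)).
by move=> h hc; rewrite uu'.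
Qed.

Lemma pullback3_eq_cube (w : form3 E) (u u' : cubes 3) s : base_differentiable u ->
  base_differentiable u' -> eq_cube u u' -> cube s ->
  pullback3 w u s = pullback3 w u' s.
Proof.
move=> du du' uu' sc; apply: eq_bigr => mu _; rewrite (uu' s sc).
congr (of_real K (\det _) *: _); apply/matrixP => a k; rewrite !mxE.
exact: dx_eq_cube.
Qed.

(** If u does not vary with s^k, the k-th column of every minor is zero. *)
Lemma pullback3_degenerate (w : form3 E) (u : cubes 3) s : base_differentiable u ->
  degenerate u -> cube s -> pullback3 w u s = 0.
Proof.
move=> du [k uk] sc; apply: big1 => mu _.
rewrite (expand_det_col _ k) big1 ?rmorph0 ?scale0r// => a _; rewrite mxE.
suff -> : dx u (@lift 4 mu a) k s = 0 by rewrite mul0r.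
apply: (real_pder_unique_on_cube sc (has_pder_dx (k := k) du sc)
  (has_pder_cst (K := real_ground R) (jx (u s) 0 (lift mu a) : R^o) k s)).
move=> h hc /=; rewrite (uk _ s)// => l lk.
by rewrite !mxE (negPf lk) andbF mulr0 addr0.
Qed.

Lemma chain_integral_eq (w : form3 E) (c c' : chains 3) :
  List.Forall (fun ku => base_differentiable ku.2) c ->
  List.Forall (fun ku => base_differentiable ku.2) c' ->
  chain_eq c c' -> chain_integral w c = chain_integral w c'.
Proof.
apply: (chain_sum_eq (I := fun u => cube_integral (pullback3 w u))).
  by move=> u u' du du' uu'; apply: cube_integral_eq => s; exact: pullback3_eq_cube.
by move=> u du ud; apply: cube_integral0 => s; exact: pullback3_degenerate.
Qed.

Lemma chain_integral_cat (w : form3 E) (c c' : chains 3) :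
  chain_integral w (c ++ c') = chain_integral w c + chain_integral w c'.
Proof. by rewrite /chain_integral big_cat. Qed.

Lemma chain_integral_opp (w : form3 E) (c : chains 3) :
  chain_integral w (chain_opp c) = - chain_integral w c.
Proof.
rewrite /chain_integral big_map -sumrN; apply: eq_bigr => ku _.
by rewrite mulrNz.
Qed.

Lemma insert_coord_line d (l : 'I_d.+1) (x : R) (s : 'rV[R]_d) k (h : R) :
  insert_coord l x (s + h *: delta_mx 0 k) =
  insert_coord l x s + h *: delta_mx 0 (lift l k).
Proof.
apply/rowP => j; rewrite !mxE /insert_ord eqxx /=.
case: unliftP => [j' ->|->]; rewrite ?mxE ?eqxx ?(inj_eq (@lift_inj _ l))//.
by rewrite eq_liftF mulr0 addr0.
Qed.

Lemma real_quotient_insert (K' : ground_field R) (F : lmodType K') d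
    (f : 'rV[R]_d.+1 -> F) l x k s :
  real_quotient (fun t => f (insert_coord l x t)) k s =
  real_quotient f (lift l k) (insert_coord l x s).
Proof. by apply/funext => h; rewrite /real_quotient insert_coord_line. Qed.

(** The difference quotients coincide as functions of the increment, so the total limits agree
    whether or not they exist. *)
Lemma dx_face d (u : cubes d.+1) l (e : bool) a k s :
  dx (face u l e) a k s = dx u a (lift l k) (insert_coord l e%:R s).
Proof.
exact: (congr1 (fun q => limit (q @ (0 : R)^')) (@real_quotient_insert (real_ground R)
  R^o d (fun t => jx (u t) 0 a) l e%:R k s)).
Qed.

Lemma base_differentiable_face d (u : cubes d.+1) l (e : bool) :
  base_differentiable u -> base_differentiable (face u l e).
Proof.
move=> du s a k sc.
have e01 : 0 <= (e%:R : R) <= 1 by case: e; rewrite ?lexx ?ler01.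
have [b hb] := du _ a (lift l k) (cube_insert l e01 sc); exists b.
rewrite /has_pder; have := @real_quotient_insert (real_ground R) R^o d
  (fun t => jx (u t) 0 a) l e%:R k s.
by move=> /(congr1 (fun q => q @ (0 : R)^' --> b)) qE; move: hb; rewrite /has_pder -qE.
Qed.

Definition minor_dx (u : cubes 4) (mu l : 'I_4) (t : 'rV[R]_4) : R :=
  \det (\matrix_(a < 3, k < 3) dx u (@lift 4 mu a) (@lift 4 l k) t).

(** The coefficient with ds^l omitted in the pullback of [w], as a function on the whole 4-cube: two
    opposite faces evaluate the same function. *)
Definition pullback4 (w : form3 E) (u : cubes 4) (l : 'I_4) (t : 'rV[R]_4) : A :=
  \sum_mu of_real K (minor_dx u mu l t) *: w mu (u t).

Lemma pullback3_face (w : form3 E) (u : cubes 4) l (e : bool) s :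
  pullback3 w (face u l e) s = pullback4 w u l (insert_coord l e%:R s).
Proof.
apply: eq_bigr => mu _.
have -> : \det (\matrix_(a < 3, k < 3) dx (face u l e) (@lift 4 mu a) k s) =
    minor_dx u mu l (insert_coord l e%:R s).
  by rewrite /minor_dx; congr (\det _); apply/matrixP => a k; rewrite !mxE dx_face.
by [].
Qed.

Lemma chain_integral_boundary (w : form3 E) (c : chains 4) :
  chain_integral w (boundary c) =
  \sum_(ku <- c) (\sum_(l < 4) (-1) ^+ l *:
    (cube_integral (fun s => pullback4 w ku.2 l (insert_coord l 1 s))
     - cube_integral (fun s => pullback4 w ku.2 l (insert_coord l 0 s)))) *~ ku.1.
Proof.
rewrite /chain_integral /boundary big_allpairs_dep /=.
apply: eq_bigr => -[k u] _ /=; rewrite /cube_boundary big_image /=.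
under eq_bigr do rewrite mulrC mulrzA.
rewrite -mulrz_suml; congr (_ *~ _).
have sgn (x : A) p : x *~ (-1) ^+ p = (-1) ^+ p *: x.
  rewrite -signr_odd -[in RHS]signr_odd.
  by case: odd; rewrite ?mulrNz ?mulr1z ?scaleN1r ?scale1r.
pose F (l : 'I_4) (e : bool) := (-1) ^+ (l + ~~ e) *:
  cube_integral (fun s => pullback4 w u l (insert_coord l e%:R s)).
transitivity (\sum_(le : 'I_4 * bool) F le.1 le.2).
  apply: eq_bigr => -[l e] _; rewrite sgn /=.
  have -> // : cube_integral (pullback3 w (face u l e)) =
      cube_integral (fun s => pullback4 w u l (insert_coord l e%:R s)).
  by apply: cube_integral_eq => s _; rewrite pullback3_face.
rewrite -(pair_bigA _ F) /=; apply: eq_bigr => l _.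
by rewrite big_bool /F addn0 addn1 scalerBr exprS mulN1r scaleNr.
Qed.

End Pullback.


(** * Conservation of the current *)

Section Minors.
Context {R : realType}.

(** The determinant as a polynomial with indices in [nat], to which the product rule, [bump] and
    [ring] apply directly. *)
Definition det3 (F : nat -> nat -> R) : R :=
  F 0 0 * (F 1 1 * F 2 2 - F 1 2 * F 2 1)
  - F 0 1 * (F 1 0 * F 2 2 - F 1 2 * F 2 0)
  + F 0 2 * (F 1 0 * F 2 1 - F 1 1 * F 2 0).

(** The differential of [det3] at [F] in the direction [G]. *)
Definition ddet3 (F G : nat -> nat -> R) : R :=
  G 0 0 * (F 1 1 * F 2 2 - F 1 2 * F 2 1)
  + F 0 0 * ((G 1 1 * F 2 2 + F 1 1 * G 2 2) - (G 1 2 * F 2 1 + F 1 2 * G 2 1))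
  - (G 0 1 * (F 1 0 * F 2 2 - F 1 2 * F 2 0)
     + F 0 1 * ((G 1 0 * F 2 2 + F 1 0 * G 2 2) - (G 1 2 * F 2 0 + F 1 2 * G 2 0)))
  + (G 0 2 * (F 1 0 * F 2 1 - F 1 1 * F 2 0)
     + F 0 2 * ((G 1 0 * F 2 1 + F 1 0 * G 2 1) - (G 1 1 * F 2 0 + F 1 1 * G 2 0))).

Lemma det3E (F : nat -> nat -> R) : \det (\matrix_(a < 3, k < 3) F a k) = det3 F.
Proof.
rewrite (expand_det_row _ ord0) !big_ord_recl big_ord0 /cofactor.
rewrite !(expand_det_row _ (@ord0 1)) !big_ord_recl !big_ord0 /cofactor !det_mx11.
by rewrite !mxE /= /det3 /bump /=; ring.
Qed.

Lemma has_pder_det3 n (F : nat -> nat -> 'rV[R]_n -> R^o) (G : nat -> nat -> R^o) k s :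
  (forall a b, @has_pder R (real_ground R) n R^o (F a b) k s (G a b)) ->
  @has_pder R (real_ground R) n R^o (fun t => det3 (fun a b => F a b t)) k s
    (ddet3 (fun a b => F a b s) G).
Proof.
move=> FG; rewrite /det3 /ddet3.
have D := @has_pderD R (real_ground R) n R^o.
have B := @has_pderB R (real_ground R) n R^o.
have M f g a b := @has_pderM R n f g k s a b.
by apply: (D); [apply: (B)|]; apply: (M) => //; apply: (B); apply: (M).
Qed.

(* The divergence of a row of cofactors of a Jacobian matrix, [H] being the
   Hessians of the three functions with gradients [F a] *)
Lemma piola (F : nat -> nat -> R) (H : nat -> nat -> nat -> R) :
  (forall a k l, H a k l = H a l k) ->
  \sum_(l < 4) (-1) ^+ l *
    ddet3 (fun a k => F a (bump l k)) (fun a k => H a (bump l k) l) = 0.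
Proof.
move=> sH; rewrite !big_ord_recl big_ord0 /ddet3 /= /bump /=.
rewrite !(sH _ 1 0)%N !(sH _ 2 0)%N !(sH _ 3 0)%N !(sH _ 2 1)%N !(sH _ 3 1)%N.
by rewrite !(sH _ 3 2)%N; ring.
Qed.

Lemma cofactor_expansion n (J : 'M[R]_n) (mu c : 'I_n) :
  \sum_l J c l * cofactor J mu l = if c == mu then \det J else 0.
Proof.
have /matrixP/(_ c mu) := mul_mx_adj J; rewrite !mxE mulrb => <-.
by apply: eq_bigr => l _; rewrite mxE.
Qed.

End Minors.


Import ArrowAsProduct.

Section LinearMaps.
Context {K : numFieldType} {V W : lmodType K} (h : V -> W).
Hypothesis h_lin : forall k u v, h (k *: u + v) = k *: h u + h v.

Lemma lin_D u v : h (u + v) = h u + h v.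
Proof. by rewrite -{1}[u]scale1r h_lin scale1r. Qed.

Lemma lin_0 : h 0 = 0.
Proof. by apply/(addrI (h 0)); rewrite -lin_D !addr0. Qed.

Lemma lin_Z k u : h (k *: u) = k *: h u.
Proof. by rewrite -[k *: u]addr0 h_lin lin_0 addr0. Qed.

Lemma lin_sum (I : Type) (r : seq I) (u : I -> V) :
  h (\sum_(j <- r) u j) = \sum_(j <- r) h (u j).
Proof. exact: (big_morph h lin_D lin_0). Qed.

End LinearMaps.

(** * Weak derivatives of the Lagrangian and the divergence of the current *)

Section LagrangianCalculus.
Context {R : realType} {K : ground_field R} {A : quantum_superalgebra K}.
Context {m n : nat} {M : quantum_supermanifold A m n} {g : lie_superalgebra A}.
Context {i : embedding M} {E : fibred_coordinates g i}.

Local Notation E1 := (E * ('I_4 -> E))%type.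

(** The content of class Q_w^2 on the whole space, with linearity over [K]. Note that [ddf]
    differentiates (w, v) |-> [df w v] in both variables, so it also contains [df] itself. *)
Record weak_derivatives (f : E1 -> A) (df : E1 -> E1 -> A)
    (ddf : E1 * E1 -> E1 * E1 -> A) : Prop := WeakDerivatives {
  wd_cont : continuous f ;
  wd1 : forall w v, quotient f w v h @[h --> (0 : K)^'] --> df w v ;
  wd1_lin : forall w (k : K) u v, df w (k *: u + v) = k *: df w u + df w v ;
  wd1_cont : continuous (fun p : E1 * E1 => df p.1 p.2) ;
  wd2 : forall p q, quotient (fun p : E1 * E1 => df p.1 p.2) p q h
    @[h --> (0 : K)^'] --> ddf p q ;
  wd2_lin : forall p (k : K) u v, ddf p (k *: u + v) = k *: ddf p u + ddf p v ;
  wd2_cont : continuous (fun p : (E1 * E1) * (E1 * E1) => ddf p.1 p.2) }.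

Lemma center_scalar (k : K) : Defs.center (k%:A : A).
Proof. by move=> a; rewrite -scalerAl -scalerAr mul1r mulr1. Qed.

Lemma zlinear_linear (V : lmodType K) (aV : A -> V -> V) (h : V -> A) :
  (forall (k : K) v, aV k%:A v = k *: v) -> zlinear_on aV (@mul_act _ _ A) setT h ->
  forall (k : K) u v, h (k *: u + v) = k *: h u + h v.
Proof.
move=> aVk hz k u v; rewrite -aVk hz//; last exact: center_scalar.
by rewrite /mul_act mulr_algl.
Qed.

Lemma lagrangian_derivatives (L : lagrangian E) x : emb_dom i x ->
  exists df ddf, weak_derivatives (lagr L x) df ddf.
Proof.
move=> ix; have [c0 [df [d1 l1 [c1 [ddf [d2 l2 [c2 _]]]]]]] := lagr_smooth L 2%N ix.
exists df, ddf.
have aE (k : K) (p : E1) :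
    (zact (k%:A : A) p.1, fun_act (@zact _ _ _ E) (k%:A : A) p.2) = k *: p.
  rewrite [RHS]surjective_pairing /= zact_scalar; congr pair.
  by apply/funext => a; exact: zact_scalar.
have T2 : [set: E1] `*` [set: E1] = setT by exact: setXTT.
have T4 : ([set: E1] `*` [set: E1]) `*` ([set: E1] `*` [set: E1]) = setT.
  by rewrite !T2; exact: setXTT.
split.
- exact/continuous_subspace_setT.
- by move=> w v; exact: d1.
- by move=> w; apply: (zlinear_linear aE); exact: l1.
- by move: c1; rewrite T2 => c1; exact/continuous_subspace_setT.
- by move=> p q; apply: d2; rewrite T2.
- move=> p; apply: zlinear_linear; last by have := l2 p (conj I I); rewrite T2; exact.
  by move=> k q; rewrite /pair_act !aE [RHS]surjective_pairing.
- by move: c2; rewrite T4 => c2; exact/continuous_subspace_setT.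
Qed.

(* The direction \partial y^mu_beta for the fibre vector [y]: [dir_y1] before
   splitting into coordinates. *)
Definition slot (mu : 'I_4) (y : E) : E1 := (0, fun a => if a == mu then y else 0).

Lemma pair_sum (V W : nmodType) (I : Type) (r : seq I) (a : I -> V) (b : I -> W) :
  \sum_(j <- r) (a j, b j) = (\sum_(j <- r) a j, \sum_(j <- r) b j).
Proof. by elim: r => [|j r IH]; rewrite ?big_nil// !big_cons IH. Qed.

Lemma sum_dir_y (y : E) : \sum_b dir_y (Defs.coord b y) = (y, 0).
Proof.
rewrite /dir_y pair_sum -sum_incl; congr pair.
by rewrite big1.
Qed.

Lemma sum_dir_y1 mu (y : E) : \sum_b dir_y1 mu (Defs.coord b y) = slot mu y.
Proof.
rewrite /dir_y1 pair_sum big1//; congr pair; apply/funext => a.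
by rewrite fct_sumE; case: ifP => _; rewrite -?sum_incl// big1.
Qed.

Lemma sum_slot (z : 'I_4 -> E) : \sum_a slot a (z a) = (0, z).
Proof.
rewrite /slot pair_sum big1//; congr pair; apply/funext => a.
rewrite fct_sumE (bigD1 a)//= eqxx big1 ?addr0// => b ba.
by rewrite eq_sym (negPf ba).
Qed.

Section Derivatives.
Variables (L : lagrangian E) (x0 : 'rV[R]_4) (ix0 : emb_dom i x0).
Variables (df : E1 -> E1 -> A) (ddf : E1 * E1 -> E1 * E1 -> A).
Hypothesis wd : weak_derivatives (lagr L x0) df ddf.

Lemma qder_lagrangian x w v : emb_dom i x -> qder (lagr L x) w v = df w v.
Proof.
move=> ix; rewrite (lagr_autonomous L ix ix0).
by apply: limit_eq; [exact: frechet_hausdorff|exact: wd1 wd _ _].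
Qed.

Lemma ddf_fst w e xi : qder (fun w => df w e) w xi = ddf (w, e) (xi, 0).
Proof.
apply: limit_eq; first exact: frechet_hausdorff.
have := wd2 wd (p := (w, e)) (q := (xi, 0)); apply: cvg_trans; apply: near_eq_cvg.
by apply: nearW => h; rewrite /quotient /= scaler0 addr0.
Qed.

(** [df w] is linear, hence its own derivative. *)
Lemma ddf_snd w e e' : ddf (w, e) (0, e') = df w e'.
Proof.
have lim : quotient (fun p : E1 * E1 => df p.1 p.2) (w, e) (0, e') h
    @[h --> (0 : K)^'] --> df w e'.
  apply: cvg_near_cst; near=> h.
  rewrite /quotient /= scaler0 addr0 [e + _]addrC (wd1_lin wd) addrK scalerA.
  rewrite mulVf ?scale1r//.
  by near: h; exact: nbhs_dnbhs_neq.
exact: (cvg_unique frechet_hausdorff (wd2 wd (p := (w, e)) (q := (0, e'))) lim).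
Unshelve. all: by end_near. Qed.

Lemma ddf_split w e xi e' : ddf (w, e) (xi, e') = ddf (w, e) (xi, 0) + df w e'.
Proof.
rewrite -(ddf_snd w e e') -(lin_D (wd2_lin wd (w, e))); congr (ddf _ _).
by congr pair; rewrite /= ?addr0 ?add0r.
Qed.

(** Here the base point varies, not the increment as in [wd2_lin]: the quotients of [df w e] with
    respect to w are linear in e, and so is their limit. *)
Lemma ddf_base_lin w xi (k : K) e e' :
  ddf (w, k *: e + e') (xi, 0) = k *: ddf (w, e) (xi, 0) + ddf (w, e') (xi, 0).
Proof.
have lim : quotient (fun p : E1 * E1 => df p.1 p.2) (w, k *: e + e') (xi, 0) h
    @[h --> (0 : K)^'] --> k *: ddf (w, e) (xi, 0) + ddf (w, e') (xi, 0).
  have := tvs_cvgD (tvs_cvgZr (k := k) (wd2 wd (p := (w, e)) (q := (xi, 0))))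
    (wd2 wd (p := (w, e')) (q := (xi, 0))).
  move=> /(_ _ _); apply: cvg_trans; apply: near_eq_cvg; apply: nearW => h.
  rewrite /quotient /= !scaler0 !addr0 !(wd1_lin wd) scalerA mulrC -scalerA -scalerDr.
  by congr (_ *: _); rewrite scalerBr addrACA -opprD.
exact: (cvg_unique frechet_hausdorff
  (wd2 wd (p := (w, k *: e + e')) (q := (xi, 0))) lim).
Qed.

(** The part of the total derivative D_mu that acts on the coordinates (y, y_a). *)
Definition jet_direction (j : jet2 E) (mu : 'I_4) : E1 :=
  (jy1 j mu, fun a => jy2 j a mu).

Lemma total_der_partial_y1 mu b (v : qcoord b) j : emb_dom i (jx j) ->
  total_der mu (fun x w => partial_y1 L mu x w v) j =
  ddf (jet1_of j, dir_y1 mu v) (jet_direction j mu, 0).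
Proof.
move=> ij; rewrite /total_der /= /partial_y1 /partial_y.
set w := jet1_of j; set e := dir_y1 mu v.
(* The explicit x-derivative is zero: [emb_dom i] is open, so small increments stay where L does not
   depend on x. *)
have -> : pder (fun x => qder (lagr L x) w e) mu (jx j) = 0.
  apply: pder_eq; first exact: frechet_hausdorff.
  apply: cvg_near_cst.
  have lim : jx j + h *: delta_mx 0 mu @[h --> (0 : R)^'] --> jx j.
    rewrite -[X in _ --> X]addr0 -(scale0r (delta_mx 0 mu)).
    apply: cvgD; first exact: cvg_cst.
    by apply: cvgZr_tmp; exact: cvg_within.
  have oi : open (emb_dom i) by exact: emb_dom_open.
  have near_i : \forall h \near (0 : R)^', emb_dom i (jx j + h *: delta_mx 0 mu).
    exact: (lim _ (open_nbhs_nbhs (conj oi ij))).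
  apply: filterS near_i => h ih.
  by rewrite /real_quotient !qder_lagrangian// subrr scaler0.
rewrite add0r.
have qE w' : qder (lagr L (jx j)) w' e = df w' e by exact: qder_lagrangian.
have -> : (fun w' => qder (lagr L (jx j)) w' e) = (fun w' => df w' e).
  exact/funext.
under eq_bigr do rewrite ddf_fst.
under [X in _ + X]eq_bigr do under eq_bigr do rewrite ddf_fst.
rewrite exchange_big /=.
pose h xi := ddf (w, e) (xi, 0).
have hlin (k : K) u v' : h (k *: u + v') = k *: h u + h v'.
  rewrite /h -(wd2_lin wd); congr (ddf _ _).
  by congr pair; rewrite /= ?scaler0 ?addr0.
rewrite -(lin_sum hlin) sum_dir_y.
under eq_bigr => a _ do rewrite -(lin_sum hlin) sum_dir_y1.
rewrite -(lin_sum hlin) sum_slot -(lin_D hlin); congr h.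
by congr pair; rewrite /= ?addr0 ?add0r.
Qed.

(** The equations for the coordinates b, taken at [coord b y] and summed, give one equation for the
    whole vector y; it will be used with y = y_4. *)
Lemma euler_lagrange_slot j (y : E) : emb_dom i (jx j) -> euler_lagrange L j ->
  df (jet1_of j) (y, 0) =
  \sum_mu ddf (jet1_of j, slot mu y) (jet_direction j mu, 0).
Proof.
move=> ij el; rewrite -sum_dir_y (lin_sum (wd1_lin wd _)).
have ddf_sum mu : ddf (jet1_of j, slot mu y) (jet_direction j mu, 0) =
    \sum_b ddf (jet1_of j, dir_y1 mu (Defs.coord b y)) (jet_direction j mu, 0).
  rewrite -sum_dir_y1.
  exact: (lin_sum (h := fun e => ddf (jet1_of j, e) (jet_direction j mu, 0))
    (fun k u v => ddf_base_lin _ _ k u v)).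
under [RHS]eq_bigr do rewrite ddf_sum.
rewrite exchange_big /=; apply: eq_bigr => b _; apply/eqP; rewrite -subr_eq0.
apply/eqP; rewrite -[RHS](el b (Defs.coord b y)); congr (_ - _).
  by rewrite /partial_y qder_lagrangian.
by apply: eq_bigr => mu _; rewrite total_der_partial_y1.
Qed.

Lemma momentumE mu a j : emb_dom i (jx j) ->
  momentum L mu a j = df (jet1_of j) (slot mu (jy1 j a)).
Proof.
move=> ij; rewrite /momentum -sum_dir_y1 (lin_sum (wd1_lin wd _)).
by apply: eq_bigr => b _; exact: qder_lagrangian.
Qed.

(* The total derivative D_c of the component T^mu of the current *)
Definition current_der (mu c : 'I_4) (j : jet2 E) : A :=
  ddf (jet1_of j, slot mu (jy1 j time))
      (jet_direction j c, slot mu (jy2 j time c))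
  - (if mu == time then df (jet1_of j) (jet_direction j c) else 0).

(** By the Euler-Lagrange equation with y = y_4, the variations of the base point add up to df (y_4,
    0); those of the slots add up to df (0, y_(4 a)). Together they cancel D_4 L = df (y_4, y_(a
    4)), by symmetry of the second-order coordinates. *)
Lemma current_divergence_free j : YM L j -> \sum_mu current_der mu mu j = 0.
Proof.
move=> [[ij sym] el]; rewrite /current_der sumrB -big_mkcond /= big_pred1_eq.
under eq_bigr do rewrite ddf_split.
rewrite big_split /= -(euler_lagrange_slot _ ij el).
rewrite -(lin_sum (wd1_lin wd _)) sum_slot -(lin_D (wd1_lin wd _)).
apply/eqP; rewrite subr_eq0; apply/eqP; congr (df _ _).
congr pair; rewrite /= ?addr0 ?add0r//.
by apply/funext => a; exact: sym.
Qed.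

End Derivatives.
End LagrangianCalculus.


Import ArrowAsProduct.

(** * Continuity at a point of the expressions to be integrated *)

Section ContinuityCombinators.

Lemma continuous_at_pair (T V W : topologicalType) (f : T -> V) (h : T -> W) s :
  {for s, continuous f} -> {for s, continuous h} ->
  {for s, continuous (fun t => (f t, h t))}.
Proof.
by move=> cf ch; apply: (@cvg_pair _ _ _ _ (nbhs (f s)) (nbhs (h s))).
Qed.

Lemma continuous_at_arrow (T V : topologicalType) n (f : T -> 'I_n -> V) s :
  (forall j, {for s, continuous (fun t => f t j)}) -> {for s, continuous f}.
Proof. by move=> cf; apply: cvg_arrow => j; exact: cf. Qed.

Lemma continuous_at_cst (T V : topologicalType) (a : V) (s : T) :
  {for s, continuous (fun=> a)}.
Proof. exact: cvg_cst. Qed.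

Lemma continuous_at_comp (T V W : topologicalType) (h : V -> W) (f : T -> V) s :
  continuous h -> {for s, continuous f} -> {for s, continuous (fun t => h (f t))}.
Proof. by move=> ch cf; apply: (cvg_comp f h cf); exact: ch. Qed.

Lemma continuous_at_det3 (R : realType) (T : topologicalType)
    (F : nat -> nat -> T -> R) s :
  (forall a b, {for s, continuous (F a b)}) ->
  {for s, continuous (fun t => det3 (fun a b => F a b t))}.
Proof.
move=> cF; have c a b : F a b t @[t --> s] --> F a b s by exact: cF.
by rewrite /continuous_at /det3; apply: cvgD; [apply: cvgB|];
  apply: cvgM => //; apply: cvgB; apply: cvgM.
Qed.

Lemma continuous_at_ddet3 (R : realType) (T : topologicalType)
    (F G : nat -> nat -> T -> R) s :
  (forall a b, {for s, continuous (F a b)}) ->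
  (forall a b, {for s, continuous (G a b)}) ->
  {for s, continuous (fun t => ddet3 (fun a b => F a b t) (fun a b => G a b t))}.
Proof.
move=> cF cG; have c a b : F a b t @[t --> s] --> F a b s by exact: cF.
have c' a b : G a b t @[t --> s] --> G a b s by exact: cG.
rewrite /continuous_at /ddet3.
have m2 a b a' b' :
    F a b t * F a' b' t @[t --> s] --> F a b s * F a' b' s by exact: cvgM.
have d2 a b a' b' : G a b t * F a' b' t + F a b t * G a' b' t @[t --> s] -->
    G a b s * F a' b' s + F a b s * G a' b' s.
  by apply: cvgD; exact: cvgM.
(* [ddet3] consists of three terms of this shape, one for each entry of the first row. *)
have term a b a1 b1 a2 b2 a3 b3 a4 b4 :
    G a b t * (F a1 b1 t * F a2 b2 t - F a3 b3 t * F a4 b4 t)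
    + F a b t * ((G a1 b1 t * F a2 b2 t + F a1 b1 t * G a2 b2 t)
      - (G a3 b3 t * F a4 b4 t + F a3 b3 t * G a4 b4 t)) @[t --> s] -->
    G a b s * (F a1 b1 s * F a2 b2 s - F a3 b3 s * F a4 b4 s)
    + F a b s * ((G a1 b1 s * F a2 b2 s + F a1 b1 s * G a2 b2 s)
      - (G a3 b3 s * F a4 b4 s + F a3 b3 s * G a4 b4 s)).
  by apply: cvgD; apply: cvgM => //; apply: cvgB; (exact: m2 || exact: d2).
by apply: cvgD; [apply: cvgB|]; exact: term.
Qed.

Lemma continuous_at_sub (K : numFieldType) (T : topologicalType)
    (V : topologicalLmodType K) (f h : T -> V) s :
  {for s, continuous f} -> {for s, continuous h} ->
  {for s, continuous (fun t => f t - h t)}.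
Proof. by move=> cf ch; apply: (tvs_cvgB (F := nbhs s)). Qed.

End ContinuityCombinators.

Section SmoothMaps.
Context {R : realType} {K : ground_field R}.

Lemma has_pder_pair n (V W : preTopologicalLmodType K) (f : 'rV[R]_n -> V)
    (h : 'rV[R]_n -> W) k s a b :
  has_pder f k s a -> has_pder h k s b ->
  has_pder (fun t => (f t, h t)) k s (a, b).
Proof. by move=> fa hb; apply: (@cvg_pair _ _ _ _ (nbhs a) (nbhs b)). Qed.

Lemma has_pder_arrow n p (V : preTopologicalLmodType K) (f : 'rV[R]_n -> 'I_p -> V)
    k s a :
  (forall j, has_pder (fun t => f t j) k s (a j)) -> has_pder f k s a.
Proof. by move=> fa; apply: cvg_arrow => j; exact: fa. Qed.

Lemma Cr_continuous n (V : preTopologicalLmodType K) r (U : set 'rV[R]_n)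
    (f : 'rV[R]_n -> V) s :
  open U -> Cr r U f -> U s -> {for s, continuous f}.
Proof.
move=> oU; case: r => [|r] [cf _] Us; move: cf; rewrite continuous_open_subspace//;
  by apply; rewrite inE.
Qed.

Lemma Cr_has_pder n (V : preTopologicalLmodType K) r (U : set 'rV[R]_n)
    (f : 'rV[R]_n -> V) k s :
  Cr r.+1 U f -> U s -> has_pder f k s (pder f k s).
Proof. by move=> [_ /(_ k)[fd _]] /fd; exact: has_pder_pder. Qed.

Lemma Cr_pder n (V : preTopologicalLmodType K) r (U : set 'rV[R]_n)
    (f : 'rV[R]_n -> V) k :
  Cr r.+1 U f -> Cr r U (pder f k).
Proof. by move=> [_ /(_ k)[]]. Qed.

End SmoothMaps.

(** * The current along an integral cube *)

Section IntegralCube.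
Context {R : realType} {K : ground_field R} {A : quantum_superalgebra K}.
Context {m n : nat} {M : quantum_supermanifold A m n} {g : lie_superalgebra A}.
Context {i : embedding M} {E : fibred_coordinates g i} (L : lagrangian E).

Local Notation E1 := (E * ('I_4 -> E))%type.
Local Notation cubes d := (@singular_cube _ _ _ _ _ _ _ _ E d).

(* The Lagrangian is taken at the fixed point [x0], as [jx (u s)] may leave
   [emb_dom i] when [s] is outside of the cube. *)
Section Currents.
Variables (d : nat) (u : cubes d) (U : set 'rV[R]_d) (x0 : 'rV[R]_4).
Hypotheses (oU : open U) (cU : @cube R d `<=` U) (ix0 : emb_dom i x0).
Hypothesis jx_smooth :
  forall a, @smooth R (real_ground R) d R^o U (fun s => jx (u s) 0 a).
Hypothesis jy_smooth : smooth U (fun s => jy (u s)).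
Hypothesis jy1_smooth : forall a, smooth U (fun s => jy1 (u s) a).
Hypothesis int_u : integral_cube L u.
Variables (df : E1 -> E1 -> A) (ddf : E1 * E1 -> E1 * E1 -> A).
Hypothesis wd : weak_derivatives (lagr L x0) df ddf.

Definition jet_pder k s : E1 :=
  (pder (fun t => jy (u t)) k s, fun a => pder (fun t => jy1 (u t) a) k s).

Lemma jet1_of_continuous s : U s -> {for s, continuous (fun t => jet1_of (u t))}.
Proof.
move=> Us; apply: continuous_at_pair.
  exact: (Cr_continuous oU (jy_smooth 0%N) Us).
by apply: continuous_at_arrow => a; exact: (Cr_continuous oU (jy1_smooth a 0%N) Us).
Qed.

Lemma jet_pder_continuous k s : U s -> {for s, continuous (jet_pder k)}.
Proof.
move=> Us; apply: continuous_at_pair.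
  exact: (Cr_continuous oU (Cr_pder k (jy_smooth 1%N)) Us).
by apply: continuous_at_arrow => a;
  exact: (Cr_continuous oU (Cr_pder k (jy1_smooth a 1%N)) Us).
Qed.

Lemma has_pder_jet1_of k s : U s ->
  has_pder (fun t => jet1_of (u t)) k s (jet_pder k s).
Proof.
move=> Us; apply: has_pder_pair; first exact: (Cr_has_pder (jy_smooth 1%N) Us).
by apply: has_pder_arrow => a; exact: (Cr_has_pder (jy1_smooth a 1%N) Us).
Qed.

Lemma slot_continuous mu s (y : 'rV[R]_d -> E) :
  {for s, continuous y} -> {for s, continuous (fun t => slot mu (y t))}.
Proof.
move=> cy; apply: continuous_at_pair; first exact: continuous_at_cst.
apply: (@continuous_at_arrow _ E 4 (fun t a => if a == mu then y t else 0)) => a.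
by case: (a == mu) => /=; [exact: cy|exact: continuous_at_cst].
Qed.

Lemma has_pder_slot mu k s (y : 'rV[R]_d -> E) dy :
  has_pder y k s dy -> has_pder (fun t => slot mu (y t)) k s (slot mu dy).
Proof.
move=> yd; apply: has_pder_pair; first exact: has_pder_cst.
by apply: has_pder_arrow => a; case: ifP => _ //; exact: has_pder_cst.
Qed.

Definition cube_momentum mu a t : A := df (jet1_of (u t)) (slot mu (jy1 (u t) a)).

Lemma cube_momentum_continuous mu a s : U s ->
  {for s, continuous (cube_momentum mu a)}.
Proof.
move=> Us; apply: (continuous_at_comp (wd1_cont wd)
  (f := fun t => (jet1_of (u t), slot mu (jy1 (u t) a)))).
apply: continuous_at_pair; first exact: jet1_of_continuous.
by apply: slot_continuous; exact: (Cr_continuous oU (jy1_smooth a 0%N) Us).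
Qed.

Lemma cube_lagrangian_continuous s : U s ->
  {for s, continuous (fun t => lagr L x0 (jet1_of (u t)))}.
Proof.
by move=> Us; apply: (continuous_at_comp (wd_cont wd)); exact: jet1_of_continuous.
Qed.

Definition cube_current mu t : A :=
  cube_momentum mu time t - (if mu == time then lagr L x0 (jet1_of (u t)) else 0).

(** Written with derivatives of the cube instead of second-order jet coordinates, it is the
    derivative of the current on all of [U]; the contact equations hold on the cube only and come in
    later. *)
Definition cube_current_der mu k t : A :=
  ddf (jet1_of (u t), slot mu (jy1 (u t) time))
      (jet_pder k t, slot mu (pder (fun t => jy1 (u t) time) k t))
  - (if mu == time then df (jet1_of (u t)) (jet_pder k t) else 0).

Lemma cube_current_continuous mu s : U s -> {for s, continuous (cube_current mu)}.
Proof.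
move=> Us; apply: continuous_at_sub; first exact: cube_momentum_continuous.
by case: (mu == time); [exact: cube_lagrangian_continuous|exact: continuous_at_cst].
Qed.

Lemma cube_current_der_continuous mu k s : U s ->
  {for s, continuous (cube_current_der mu k)}.
Proof.
move=> Us; have cj := jet1_of_continuous Us; have cd := @jet_pder_continuous k s Us.
apply: continuous_at_sub.
  apply: (continuous_at_comp (wd2_cont wd) (f := fun t =>
    ((jet1_of (u t), slot mu (jy1 (u t) time)),
     (jet_pder k t, slot mu (pder (fun t => jy1 (u t) time) k t))))).
  apply: continuous_at_pair; apply: continuous_at_pair => //; apply: slot_continuous.
    exact: (Cr_continuous oU (jy1_smooth time 0%N) Us).
  exact: (Cr_continuous oU (Cr_pder k (jy1_smooth time 1%N)) Us).
case: (mu == time); last exact: continuous_at_cst.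
apply: (continuous_at_comp (wd1_cont wd)
  (f := fun t => (jet1_of (u t), jet_pder k t))).
exact: continuous_at_pair.
Qed.

Lemma line_continuous_jet : line_continuous E1.
Proof.
apply: line_continuous_prod; first exact: line_continuous_tvs.
by apply: line_continuous_arrow; exact: line_continuous_tvs.
Qed.

Lemma has_pder_cube_current mu k s : U s ->
  has_pder (cube_current mu) k s (cube_current_der mu k s).
Proof.
move=> Us; apply: has_pderB.
  apply: (@has_pder_comp _ _ _ _ _ (fun p : E1 * E1 => df p.1 p.2) ddf
    (fun t => (jet1_of (u t), slot mu (jy1 (u t) time))) k s).
  - by apply: line_continuous_prod; exact: line_continuous_jet.
  - exact: wd2 wd.
  - exact: wd2_cont wd.
  - apply: has_pder_pair; first exact: has_pder_jet1_of.
    by apply: has_pder_slot; exact: (Cr_has_pder (jy1_smooth time 1%N) Us).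
case: (mu == time); last exact: has_pder_cst.
apply: (@has_pder_comp _ _ _ _ _ (lagr L x0) df (fun t => jet1_of (u t)) k s).
- exact: line_continuous_jet.
- exact: wd1 wd.
- exact: wd1_cont wd.
- exact: has_pder_jet1_of.
Qed.

(** The contact equations say that d/ds^k acts on 1-jets as \sum_c (dx^c/ds^k) D_c. *)
Lemma jet_pder_integral k s : cube s ->
  jet_pder k s = \sum_c of_real K (dx u c k s) *: jet_direction (u s) c.
Proof.
move=> sc; have [_ _ iy iy1] := int_u.
rewrite /jet_pder iy//.
have -> : \sum_c of_real K (dx u c k s) *: jet_direction (u s) c =
    \sum_c (of_real K (dx u c k s) *: jy1 (u s) c,
            of_real K (dx u c k s) *: (fun a => jy2 (u s) a c)) by [].
rewrite pair_sum; congr pair; apply/funext => a.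
by rewrite fct_sumE iy1.
Qed.

Lemma slot_lin mu (a : K) (y z : E) :
  slot mu (a *: y + z) = a *: slot mu y + slot mu z :> E1.
Proof.
rewrite /slot; congr pair; rewrite /= ?scaler0 ?addr0//.
apply/funext => b.
transitivity (a *: (if b == mu then y else 0) + (if b == mu then z else 0)).
  by case: (b == mu); rewrite ?scaler0 ?addr0.
by [].
Qed.

Lemma cube_current_der_integral mu k s : cube s ->
  cube_current_der mu k s =
  \sum_c of_real K (dx u c k s) *: current_der df ddf mu c (u s).
Proof.
move=> sc; have [_ _ _ iy1] := int_u.
rewrite /cube_current_der /current_der jet_pder_integral// iy1//.
under [RHS]eq_bigr do rewrite scalerBr.
rewrite sumrB; congr (_ - _).
  have -> : slot mu (\sum_c of_real K (dx u c k s) *: jy2 (u s) time c) =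
      \sum_c of_real K (dx u c k s) *: slot mu (jy2 (u s) time c).
    rewrite (lin_sum (slot_lin mu)); apply: eq_bigr => c _.
    exact: (lin_Z (slot_lin mu)).
  have -> : (\sum_c of_real K (dx u c k s) *: jet_direction (u s) c,
      \sum_c of_real K (dx u c k s) *: slot mu (jy2 (u s) time c)) =
      \sum_c of_real K (dx u c k s) *:
        (jet_direction (u s) c, slot mu (jy2 (u s) time c)) :> E1 * E1.
    by rewrite -[LHS]pair_sum.
  rewrite (lin_sum (wd2_lin wd _)); apply: eq_bigr => c _.
  exact: (lin_Z (wd2_lin wd _)).
case: ifP => _; last by rewrite big1// => c _; rewrite scaler0.
rewrite (lin_sum (wd1_lin wd _)); apply: eq_bigr => c _.
exact: (lin_Z (wd1_lin wd _)).
Qed.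

End Currents.
End IntegralCube.


(** * Closedness of the pullback of omega_H *)

Section ClosedCurrent.
Context {R : realType} {K : ground_field R} {A : quantum_superalgebra K}.
Context {m n : nat} {M : quantum_supermanifold A m n} {g : lie_superalgebra A}.
Context {i : embedding M} {E : fibred_coordinates g i} (L : lagrangian E).

Local Notation E1 := (E * ('I_4 -> E))%type.
Local Notation cubes d := (@singular_cube _ _ _ _ _ _ _ _ E d).
Local Notation real_has_pder := (@has_pder R (real_ground R) _ R^o).

Section Minors.
Variables (d : nat) (u : cubes d) (U : set 'rV[R]_d).
Hypotheses (oU : open U).
Hypothesis jx_smooth :
  forall a, @smooth R (real_ground R) d R^o U (fun s => jx (u s) 0 a).

Definition dx2 a k l t : R := @pder R (real_ground R) d R^o (dx u a k) l t.

Lemma dx_continuous a k t : U t -> {for t, continuous (dx u a k : _ -> R^o)}.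
Proof.
by move=> Ut; exact: (Cr_continuous oU (Cr_pder k (jx_smooth a 1%N)) Ut).
Qed.

Lemma dx2_continuous a k l t : U t -> {for t, continuous (dx2 a k l : _ -> R^o)}.
Proof.
move=> Ut.
exact: (Cr_continuous oU (Cr_pder l (Cr_pder k (jx_smooth a 2%N))) Ut).
Qed.

Lemma has_pder_dx2 a k l t : U t -> real_has_pder (dx u a k) l t (dx2 a k l t).
Proof. by move=> Ut; exact: (Cr_has_pder (Cr_pder k (jx_smooth a 2%N)) Ut). Qed.

Lemma dx2_sym a k l t : U t -> dx2 a k l t = dx2 a l k t.
Proof.
move=> Ut; apply: (@mixed_partials R (real_ground R) R^o d
  (fun s => jx (u s) 0 a) (dx u a k) (dx u a l) (dx2 a k l) (dx2 a l k) k l t U).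
- exact: norm_hausdorff.
- exact: open_nbhs_nbhs.
- by move=> s Us; exact: (Cr_has_pder (jx_smooth a 1%N) Us).
- by move=> s Us; exact: (Cr_has_pder (jx_smooth a 1%N) Us).
- by move=> s Us; exact: has_pder_dx2.
- by move=> s Us; exact: has_pder_dx2.
- exact: dx2_continuous.
- exact: dx2_continuous.
Qed.

End Minors.

Lemma inord_lift p (h : 'I_p.+1) (j : 'I_p) : inord (bump h j) = lift h j.
Proof. by apply/val_inj; rewrite /= inordK// ltnS; have := ltn_ord (lift h j). Qed.

Lemma minor_dx_det3 (u : cubes 4) mu l : minor_dx u mu l =
  fun t => det3 (fun a k => dx u (inord (bump mu a)) (inord (bump l k)) t).
Proof.
apply/funext => t; rewrite -det3E /minor_dx; congr (\det _); apply/matrixP => a k.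
by rewrite !mxE !inord_lift.
Qed.

Section ClosedForm.
Variables (u : cubes 4) (U : set 'rV[R]_4) (x0 : 'rV[R]_4).
Hypotheses (oU : open U) (cU : @cube R 4 `<=` U) (ix0 : emb_dom i x0).
Hypothesis jx_smooth :
  forall a, @smooth R (real_ground R) 4 R^o U (fun s => jx (u s) 0 a).
Hypothesis jy_smooth : smooth U (fun s => jy (u s)).
Hypothesis jy1_smooth : forall a, smooth U (fun s => jy1 (u s) a).
Hypothesis int_u : integral_cube L u.
Variables (df : E1 -> E1 -> A) (ddf : E1 * E1 -> E1 * E1 -> A).
Hypothesis wd : weak_derivatives (lagr L x0) df ddf.

Local Notation current := (cube_current L u x0 df).
Local Notation current' := (cube_current_der u df ddf).

Definition dminor (mu l : 'I_4) t : R :=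
  ddet3 (fun a k => dx u (inord (bump mu a)) (inord (bump l k)) t)
        (fun a k => dx2 u (inord (bump mu a)) (inord (bump l k)) l t).

Lemma has_pder_minor (mu l : 'I_4) t : U t ->
  real_has_pder (minor_dx u mu l) l t (dminor mu l t).
Proof.
move=> Ut; rewrite minor_dx_det3.
by apply: has_pder_det3 => a k; exact: (has_pder_dx2 jx_smooth).
Qed.

Lemma minor_continuous (mu l : 'I_4) t : U t ->
  {for t, continuous (minor_dx u mu l : _ -> R^o)}.
Proof.
move=> Ut; rewrite minor_dx_det3.
by apply: continuous_at_det3 => a k; exact: (dx_continuous oU jx_smooth).
Qed.

Lemma dminor_continuous (mu l : 'I_4) t : U t ->
  {for t, continuous (dminor mu l : _ -> R^o)}.
Proof.
move=> Ut; apply: continuous_at_ddet3 => a k.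
  exact: (dx_continuous oU jx_smooth).
exact: (dx2_continuous oU jx_smooth).
Qed.

(** [piola] for the gradients and Hessians of the three functions x^a with a different from mu.
    [inord] sends indices out of range to a valid one, so the symmetry holds for all naturals. *)
Lemma dminor_sum (mu : 'I_4) t : U t -> \sum_(l < 4) (-1) ^+ l * dminor mu l t = 0.
Proof.
move=> Ut.
have := @piola R (fun a k => dx u (inord (bump mu a)) (inord k) t)
  (fun a k l => dx2 u (inord (bump mu a)) (inord k) (inord l) t).
rewrite /dminor => pio; rewrite -[RHS]pio; last first.
  by move=> a k l; exact: (dx2_sym oU jx_smooth).
by apply: eq_bigr => l _; rewrite inord_val.
Qed.

(* The coefficient of the pullback of omega_H with ds^l omitted *)
Definition closed_form l t : A :=
  \sum_mu of_real K (minor_dx u mu l t) *: ((-1) ^+ (mu : nat) *: current mu t).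

Definition closed_form' l t : A :=
  \sum_mu (of_real K (dminor mu l t) *: ((-1) ^+ (mu : nat) *: current mu t)
    + of_real K (minor_dx u mu l t) *: ((-1) ^+ (mu : nat) *: current' mu l t)).

Lemma has_pder_closed_form l t : U t ->
  has_pder (closed_form l) l t (closed_form' l t).
Proof.
move=> Ut; apply: has_pder_sum => mu _; apply: has_pderZ; first exact: has_pder_minor.
by apply: has_pderZr; exact: (has_pder_cube_current jy_smooth jy1_smooth wd).
Qed.

Lemma of_real_scale_continuous (T : topologicalType) (c : T -> R) (f : T -> A) t :
  {for t, continuous (c : _ -> R^o)} -> {for t, continuous f} ->
  {for t, continuous (fun s => of_real K (c s) *: f s)}.
Proof.
move=> cc cf; apply: (tvs_cvgZ (F := nbhs t)) => //.
by apply: (continuous_at_comp (@of_real_continuous R K)).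
Qed.

Lemma scale_continuous_at (T : topologicalType) (k : K) (f : T -> A) t :
  {for t, continuous f} -> {for t, continuous (fun s => k *: f s)}.
Proof. by move=> cf; apply: (tvs_cvgZr (F := nbhs t)). Qed.

Lemma closed_form_continuous l t : U t -> {for t, continuous (closed_form l)}.
Proof.
move=> Ut; apply: (tvs_cvg_sum (F := nbhs t)) => mu _.
apply: of_real_scale_continuous; first exact: minor_continuous.
apply: scale_continuous_at.
exact: (cube_current_continuous oU jy_smooth jy1_smooth wd).
Qed.

Lemma closed_form'_continuous l t : U t -> {for t, continuous (closed_form' l)}.
Proof.
move=> Ut; apply: (tvs_cvg_sum (F := nbhs t)) => mu _.
apply: (tvs_cvgD (F := nbhs t)).
  apply: of_real_scale_continuous; first exact: dminor_continuous.
  apply: scale_continuous_at.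
  exact: (cube_current_continuous oU jy_smooth jy1_smooth wd).
apply: of_real_scale_continuous; first exact: minor_continuous.
apply: scale_continuous_at.
exact: (cube_current_der_continuous oU jy_smooth jy1_smooth wd).
Qed.

(** The terms with differentiated minors cancel by [dminor_sum]. In the others d/ds^l is \sum_c J c
    l D_c, and contracting with the cofactors of row mu leaves det J times D_mu T^mu; the sum over
    mu is det J times the divergence. *)
Lemma closed_form_closed t : cube t -> \sum_(l < 4) (-1) ^+ l *: closed_form' l t = 0.
Proof.
move=> tc; have Ut := cU tc.
pose J := \matrix_(c < 4, l < 4) dx u c l t.
(* The sign (-1)^mu of omega_H and the sign (-1)^l of the boundary make the minor a cofactor of
   [J]. *)
have cofE (mu l : 'I_4) : (-1) ^+ (l : nat) *: (of_real K (minor_dx u mu l t) *: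
      ((-1) ^+ (mu : nat) *: current' mu l t)) =
    of_real K (cofactor J mu l) *: current' mu l t.
  rewrite /cofactor (_ : \det (row' _ _) = minor_dx u mu l t); last first.
    by congr (\det _); apply/matrixP => a k; rewrite !mxE.
  rewrite rmorphM rmorphXn rmorphN rmorph1 exprD !scalerA; congr (_ *: _); ring.
have dminE (mu l : 'I_4) : (-1) ^+ (l : nat) *: (of_real K (dminor mu l t) *:
      ((-1) ^+ (mu : nat) *: current mu t)) =
    of_real K ((-1) ^+ (l : nat) * dminor mu l t) *: ((-1) ^+ (mu : nat) *: current mu t).
  by rewrite scalerA rmorphM rmorphXn rmorphN rmorph1.
under eq_bigr do rewrite scaler_sumr.
rewrite exchange_big /=.
under eq_bigr => mu _.
  under eq_bigr do rewrite scalerDr dminE cofE.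
  rewrite big_split /= -scaler_suml -rmorph_sum dminor_sum// rmorph0 scale0r add0r.
  under eq_bigr do rewrite (cube_current_der_integral int_u wd)// scaler_sumr.
  rewrite exchange_big /=.
  under eq_bigr => c _.
    under eq_bigr do rewrite scalerA -rmorphM mulrC.
    rewrite -scaler_suml -rmorph_sum.
    rewrite (_ : \sum_(l < 4) _ = if c == mu then \det J else 0); last first.
      by rewrite -cofactor_expansion; apply: eq_bigr => l _; rewrite mxE.
    over.
  rewrite (bigD1 mu)//= eqxx big1 ?addr0; last first.
    by move=> c /negPf ->; rewrite rmorph0 scale0r.
  over.
rewrite -scaler_sumr (current_divergence_free ix0 wd) ?scaler0//.
by have [_ + _ _] := int_u; exact.
Qed.

Lemma pullback4_omegaH l t : cube t -> pullback4 (omegaH L) u l t = closed_form l t.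
Proof.
move=> tc; have [_ yu _ _] := int_u; have [[it _] _] := yu t tc.
apply: eq_bigr => mu _; congr (_ *: _).
rewrite /omegaH (momentumE ix0 wd)// /lagr_at (lagr_autonomous L it ix0).
rewrite -signr_odd -[in RHS]signr_odd; case: odd => /=.
  by rewrite !expr1 mulN1r scaleN1r.
by rewrite !expr0 mul1r scale1r.
Qed.

Lemma stokes_closed_form : \sum_(l < 4) (-1) ^+ l *:
  (cube_integral (fun s => pullback4 (omegaH L) u l (insert_coord l 1 s))
   - cube_integral (fun s => pullback4 (omegaH L) u l (insert_coord l 0 s))) = 0.
Proof.
have faceE l (x : R) : 0 <= x <= 1 ->
    cube_integral (fun s => pullback4 (omegaH L) u l (insert_coord l x s)) =
    cube_integral (fun s => closed_form l (insert_coord l x s)).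
  move=> x01; apply: cube_integral_eq => s sc.
  by rewrite pullback4_omegaH//; exact: cube_insert.
rewrite -[RHS](@stokes_cube R K A 3 closed_form closed_form').
- apply: eq_bigr => l _; rewrite !faceE ?lexx ?ler01//.
- by move=> l s /cU; exact: has_pder_closed_form.
- by move=> l; apply: uniform_on_cube_continuous => s /cU; exact: closed_form_continuous.
- by move=> l; apply: uniform_on_cube_continuous => s /cU; exact: closed_form'_continuous.
- exact: closed_form_closed.
Qed.

End ClosedForm.
End ClosedCurrent.


(** * Energies *)

Section Energies.
Context {R : realType} {K : ground_field R} {A : quantum_superalgebra K}.
Context {m n : nat} {M : quantum_supermanifold A m n} {g : lie_superalgebra A}.
Context {i : embedding M} {E : fibred_coordinates g i} (L : lagrangian E).

Local Notation cubes d := (@singular_cube _ _ _ _ _ _ _ _ E d).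
Local Notation chains d := (@chain _ _ _ _ _ _ _ _ E d).

Lemma cube0 d : cube (0 : 'rV[R]_d).
Proof. by move=> k; rewrite mxE lexx ler01. Qed.

Lemma omegaH_boundary_cube (u : cubes 4) : integral_cube L u ->
  \sum_(l < 4) (-1) ^+ l *:
    (cube_integral (fun s => pullback4 (omegaH L) u l (insert_coord l 1 s))
     - cube_integral (fun s => pullback4 (omegaH L) u l (insert_coord l 0 s))) = 0.
Proof.
move=> int_u; have [[U [oU cU [sx sy sy1 _]]] yu _ _] := int_u.
(* The fixed base point is the image of the corner 0 of the cube. *)
have [[ix0 _] _] := yu _ (@cube0 4).
have [df [ddf wd]] := lagrangian_derivatives L ix0.
exact: (stokes_closed_form oU cU ix0 sx sy sy1 int_u wd).
Qed.

Lemma omegaH_boundary (c : chains 4) : integral_chain L c ->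
  chain_integral (omegaH L) (boundary c) = 0.
Proof.
move=> ic; rewrite chain_integral_boundary.
elim: c ic => [|ku c IH] ic; first by rewrite big_nil.
inversion ic; subst; rewrite big_cons IH// addr0.
by rewrite omegaH_boundary_cube// mul0rz.
Qed.

Lemma integral_chain_differentiable d (c : chains d) : integral_chain L c ->
  List.Forall (fun ku => base_differentiable ku.2) c.
Proof.
by apply: List.Forall_impl => ku [su _ _ _]; exact: smooth_cube_base_differentiable.
Qed.

Lemma boundary_differentiable d (c : chains d.+1) :
  List.Forall (fun ku => base_differentiable ku.2) c ->
  List.Forall (fun ku => base_differentiable ku.2) (boundary c).
Proof.
have Forall_cat (r r' : chains d) :
    List.Forall (fun ku => base_differentiable ku.2) r ->
    List.Forall (fun ku => base_differentiable ku.2) r' ->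
    List.Forall (fun ku => base_differentiable ku.2) (r ++ r').
  by move=> ur ur'; apply/List.Forall_app.
elim: c => [|[k u] c IH] uc; first exact: List.Forall_nil.
inversion uc; subst; rewrite /boundary /=; apply: Forall_cat; last exact: IH.
rewrite /cube_boundary /image_mem.
elim: (enum _) => [|le r IHr] /=; first exact: List.Forall_nil.
by apply: List.Forall_cons => //=; exact: base_differentiable_face.
Qed.

Lemma opp_differentiable d (c : chains d) :
  List.Forall (fun ku => base_differentiable ku.2) c ->
  List.Forall (fun ku => base_differentiable ku.2) (chain_opp c).
Proof.
elim: c => [|ku c IH] uc; first exact: List.Forall_nil.
by inversion uc; subst; apply: List.Forall_cons => //; exact: IH.
Qed.

(** [h] along u is known only on the cube; [h'] is a continuous function on [U] that agrees with it
    there. *)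
Lemma uniform_volume_form (h : jet2 E -> A) (h' : 'rV[R]_3 -> A) (u : cubes 3)
    (U : set 'rV[R]_3) : open U -> @cube R 3 `<=` U ->
  (forall a, @smooth R (real_ground R) 3 R^o U (fun s => jx (u s) 0 a)) ->
  (forall s, U s -> {for s, continuous h'}) ->
  (forall s, cube s -> h (u s) = h' s) ->
  uniform_on_cube (pullback3 (volume_form h) u).
Proof.
move=> oU cU sx ch' hh'.
pose f s := of_real K (det3 (fun a k => dx u (inord (bump time a)) (inord k) s)) *: h' s.
have pE s : cube s -> pullback3 (volume_form h) u s = f s.
  move=> sc; rewrite /pullback3 (bigD1 time)//= big1 ?addr0; last first.
    by move=> mu /negPf; rewrite /volume_form => ->; rewrite scaler0.
  rewrite /volume_form eqxx hh'// /f -det3E; congr (of_real K (\det _) *: _).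
  by apply/matrixP => a k; rewrite !mxE inord_lift inord_val.
have uf : uniform_on_cube f.
  apply: uniform_on_cube_continuous => s /cU Us.
  apply: of_real_scale_continuous; last exact: ch'.
  by apply: continuous_at_det3 => a k; exact: (dx_continuous oU sx).
by move=> B /uf[e e0 eB]; exists e => // s t sc tc; rewrite !pE//; exact: eB.
Qed.

Definition spatial_momentum (j : jet2 E) : A := \sum_(a | a != time) momentum L a a j.

(** Minors with a row dx^4 vanish. In the remaining component mu = [time] has index 3, so the sign
    is -1 and the coefficient is L minus the temporal momentum term, that is, the spatial terms
    minus H. *)
Lemma pullback3_omegaH_space_like t (u : cubes 3) s : base_differentiable u ->
  (forall s, cube s -> jx (u s) 0 time = t) -> cube s ->
  pullback3 (omegaH L) u s =
  pullback3 (volume_form spatial_momentum) u s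
  - pullback3 (volume_form (hamiltonian L)) u s.
Proof.
move=> du ut sc.
have det0 mu : mu != time ->
    \det (\matrix_(a < 3, k < 3) dx u (@lift 4 mu a) k s) = 0.
  case: (unliftP mu time) => [a timeE _|->]; last by rewrite eqxx.
  rewrite (expand_det_row _ a) big1// => k _; rewrite mxE -timeE.
  suff -> : dx u time k s = 0 by rewrite mul0r.
  apply: (real_pder_unique_on_cube sc (has_pder_dx (a := time) (k := k) du sc)
    (has_pder_cst (K := real_ground R) (t : R^o) k s)) => h hc.
  exact: ut.
rewrite /pullback3 -sumrB; apply: eq_bigr => mu _.
have [->|mut] := eqVneq mu time; last by rewrite det0// rmorph0 !scale0r subr0.
rewrite -scalerBr /volume_form /omegaH eqxx; congr (_ *: _).
rewrite /hamiltonian (bigD1 time)//= -/(spatial_momentum _).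
rewrite -signr_odd /= expr1 mulN1r opprB [momentum _ _ _ _ + _]addrC.
by rewrite opprB addrCA opprD addNKr.
Qed.

(** Being a total limit, [cube_integral] can be split only once both Riemann sums are known to
    converge; hence [um] and [uh]. *)
Lemma omegaH_space_like_cube t (u : cubes 3) : integral_cube L u ->
  (forall s, cube s -> jx (u s) 0 time = t) ->
  cube_integral (pullback3 (omegaH L) u) =
  cube_integral (pullback3 (volume_form spatial_momentum) u)
  - cube_integral (pullback3 (volume_form (hamiltonian L)) u).
Proof.
move=> int_u ut; have [su yu _ _] := int_u; have [U [oU cU [sx sy sy1 _]]] := su.
have [[ix0 _] _] := yu _ (@cube0 3).
have [df [ddf wd]] := lagrangian_derivatives L ix0.
set x0 := jx _ in ix0 wd.
have ixu s : cube s -> emb_dom i (jx (u s)) by move=> /yu[[]].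
have mc mu a s : U s -> {for s, continuous (cube_momentum u df mu a)}.
  exact: (cube_momentum_continuous oU sy sy1 wd).
have lc s : U s -> {for s, continuous (fun t => lagr L x0 (jet1_of (u t)))}.
  exact: (cube_lagrangian_continuous oU sy sy1 wd).
have um : uniform_on_cube (pullback3 (volume_form spatial_momentum) u).
  apply: (uniform_volume_form oU cU sx
    (h' := fun s => \sum_(a | a != time) cube_momentum u df a a s)).
    by move=> s Us; apply: (tvs_cvg_sum (F := nbhs s)) => a _; exact: mc.
  by move=> s sc; apply: eq_bigr => a _; rewrite (momentumE ix0 wd)//; exact: ixu.
have uh : uniform_on_cube (pullback3 (volume_form (hamiltonian L)) u).
  apply: (uniform_volume_form oU cU sx
    (h' := fun s => \sum_a cube_momentum u df a a s - lagr L x0 (jet1_of (u s)))).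
    move=> s Us; apply: continuous_at_sub; last exact: lc.
    by apply: (tvs_cvg_sum (F := nbhs s)) => a _; exact: mc.
  move=> s sc; rewrite /hamiltonian /lagr_at (lagr_autonomous L (ixu s sc) ix0).
  by congr (_ - _); apply: eq_bigr => a _; rewrite (momentumE ix0 wd)//; exact: ixu.
apply: limit_eq; first exact: frechet_hausdorff.
have lim := tvs_cvgB (riemann_cvg um) (riemann_cvg uh).
apply: cvg_trans (lim _); apply: near_eq_cvg; apply: nearW => N.
rewrite /riemann_sum -scalerBr -sumrB; congr (_ *: _); apply: eq_bigr => k _.
rewrite (pullback3_omegaH_space_like (smooth_cube_base_differentiable su) ut)//.
exact: cube_grid.
Qed.

Lemma energy_difference t (c : chains 3) : integral_chain L c -> space_like t c ->
  energy0 L c - energy00 L c = - chain_integral (omegaH L) c.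
Proof.
rewrite /energy0 /energy00 /chain_integral => ic sc.
rewrite -sumrB -sumrN; elim: c ic sc => [|ku c IH] ic sc; first by rewrite !big_nil.
inversion ic; inversion sc; subst; rewrite !big_cons IH//; congr (_ + _).
rewrite (omegaH_space_like_cube (t := t))// -mulrzBl -mulNrz opprB.
by [].
Qed.

End Energies.

Theorem corollary3p28 (R : realType) (K : ground_field R)
    (A : quantum_superalgebra K) (m n : nat) (M : quantum_supermanifold A m n)
    (g : lie_superalgebra A) (i : embedding M) (E : fibred_coordinates g i)
    (L : lagrangian E) (t0 t1 : R) (V : propagator L t0 t1) :
  (energy0 L (section0 V) = energy0 L (section1 V) <-> defect_energy V = 0)
  /\ energy0 L (section0 V) - energy0 L (section1 V) = defect_energy V.
Proof.
suff eqV : energy0 L (section0 V) - energy0 L (section1 V) = defect_energy V.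
  split=> //; rewrite -eqV; split=> [->|/eqP]; first by rewrite subrr.
  by rewrite subr_eq0 => /eqP.
have c0 := energy_difference (cauchy0_integral V) (cauchy0_space_like V).
have c1 := energy_difference (cauchy1_integral V) (cauchy1_space_like V).
have dif d c := @integral_chain_differentiable R K A m n M g i E L d c.
(* [body_boundary] is an equality modulo degenerate cubes and up to values outside of the cube;
   [chain_integral_eq] carries it over to integrals. *)
have stokes : chain_integral (omegaH L) (cauchy0 V)
    - chain_integral (omegaH L) (cauchy1 V) + chain_integral (omegaH L) (lateral V) = 0.
  rewrite -(omegaH_boundary (body_integral V)).
  rewrite (chain_integral_eq (omegaH L) _ _ (body_boundary V)).
  - by rewrite !chain_integral_cat chain_integral_opp addrA.
  - by apply: boundary_differentiable; exact: dif (body_integral V).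
  - apply/List.Forall_app; split; first exact: dif (cauchy0_integral V).
    apply/List.Forall_app; split; last exact: dif (lateral_integral V).
    by apply: opp_differentiable; exact: dif (cauchy1_integral V).
rewrite /defect_energy /phenomenological_defect.
have energy0_opp c : energy0 L (chain_opp c) = - energy0 L c.
  exact: chain_integral_opp.
have energy00_opp c : energy00 L (chain_opp c) = - energy00 L c.
  exact: chain_integral_opp.
rewrite !energy0_opp !energy00_opp !opprK.
(* Each energy becomes its spatial part minus the integral of omega_H, and the Stokes relation
   trades the integrals over N_0 and N_1 for the one over P. *)
move/eqP: c0; rewrite subr_eq => /eqP ->; move/eqP: c1; rewrite subr_eq => /eqP ->.
move/eqP: stokes; rewrite addrC addr_eq0 opprB => /eqP ->.
by rewrite opprD opprK opprB addrACA addrC.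
Qed.
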